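(* Let $a,b:[0,+\infty)\to\mathbb R$ be Lebesgue measurable and essentially bounded, and let $g,h:[0,+\infty)\to\mathbb R$ be Lebesgue measurable and locally essentially bounded, with $g(t)\le t$, $h(t)\le t$, $\lim_{t\to+\infty}g(t)=+\infty$, $\lim_{t\to+\infty}h(t)=+\infty$, and such that for every Lebesgue null set $U\subset\mathbb R$ the sets $g^{-1}(U)$ and $h^{-1}(U)$ are Lebesgue null. Let $t_0\ge0$ and $a_0<1$ be such that $\|a\|_{[t_0,+\infty)}\le a_0<1$. Assume that $b(t)\ge0$, $\int_0^{+\infty}b(s)\,ds=+\infty$, $b(t)\ne0$ almost everywhere, $$\limsup_{t\to+\infty}\int_{g(t)}^t b(\xi)\,d\xi<+\infty,\qquad \limsup_{t\to+\infty}\int_{h(t)}^t b(\xi)\,d\xi<+\infty,$$ and that at least one of the following conditions holds for $t\ge t_0$: a) $\displaystyle\int_{h(t)}^t b(\xi)\,d\xi\le\frac1e$ and $\displaystyle\|a\|_{[t_0,+\infty)}<\frac12$; b) $\displaystyle\frac1e<\int_{h(t)}^t b(\xi)\,d\xi<1+\frac1e-2\|a\|_{[t_0,+\infty)}$. Then the equation $$(x(t)-a(t)x(g(t)))'+b(t)x(h(t))=0$$ is asymptotically stable.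
   Context: Notation: $\|u\|_{[t_0,+\infty)}=\operatorname{ess\,sup}_{t\ge t_0}|u(t)|$. Equalities and inequalities between measurable functions, and limits of solutions, are understood up to null sets of $t$; the function $a$ is represented by an everywhere defined function with $|a(t)|\le\|a\|_{[t_0,+\infty)}$ for all $t\ge t_0$. In integrals of $b$, one puts $b(t)=0$ for $t<0$. Solution: for an initial point $\sigma\ge t_0$ and a bounded Borel measurable initial function $\varphi:(-\infty,\sigma]\to\mathbb R$, a solution of the initial value problem $$(x(t)-a(t)x(g(t)))'+b(t)x(h(t))=0,\ t\ge\sigma,\qquad x(t)=\varphi(t),\ t\le\sigma,$$ is a Lebesgue measurable function $x:\mathbb R\to\mathbb R$, locally essentially bounded on $[\sigma,+\infty)$, such that $t\mapsto x(t)-a(t)x(g(t))$ is locally absolutely continuous on $[\sigma,+\infty)$, the differential equation holds for almost all $t\ge\sigma$, and $x(t)=\varphi(t)$ for $t\le\sigma$. (Such a solution exists and is unique.) Asymptotic stability: the equation is asymptotically stable if it is stable, i.e. for every initial point $\sigma\ge t_0$ and every $\varepsilon>0$ there is $\eta>0$ such that $\sup_{r\le\sigma}|\varphi(r)|<\eta$ implies $|x(t)|<\varepsilon$ for $t\ge\sigma$, and every such solution satisfies $\lim_{t\to+\infty}x(t)=0$.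
   Formalization: The inequality g(t) ≤ t is assumed for every t ≥ 0 rather than up to null sets; otherwise x(σ) − a(σ)x(g(σ)) need not be determined by φ, and uniqueness and stability fail (e.g. a = 1/4, g(n) = n+1 at integers, g(t) = t−1 elsewhere). *)

(* Defs.v *)
From HB Require Import structures.
From mathcomp Require Import all_boot all_order all_algebra.
From mathcomp Require Import all_classical all_reals all_analysis.
From mathcomp Require Import ess_sup_inf.

Set Implicit Arguments.
Unset Strict Implicit.
Unset Printing Implicit Defensive.

Import Order.TTheory GRing.Theory Num.Theory.
Import numFieldNormedType.Exports.

Local Open Scope classical_set_scope.
Local Open Scope ring_scope.

(* The real line with the sigma-algebra of Lebesgue measurable sets; R itself
   carries the Borel sigma-algebra. *)
Notation lebesgueT R := (caratheodory_type ((@wlength R idfun)^*)%mu).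

Notation leb R := (@completed_lebesgue_measure R).

Definition lebesgue_measurable_fun (R : realType) (D : set R) (f : R -> R) :
  Prop := measurable_fun (D : set (lebesgueT R)) (f : lebesgueT R -> R).

(* Extending f by 0 outside D leaves the essential supremum of |f| over D
   unchanged when D is not negligible. *)
Definition ess_norm (R : realType) (D : set R) (f : R -> R) : \bar R :=
  ess_sup (leb R) (fun t : R => `|patch (fun=> 0) D f t|%:E).

Definition loc_ess_bounded (R : realType) (s : R) (f : R -> R) : Prop :=
  forall T : R, (ess_norm `[s, T] f < +oo)%E.

Definition null_preimage (R : realType) (D : set R) (f : R -> R) : Prop :=
  forall U : set R,
    (leb R).-negligible U -> (leb R).-negligible (D `&` f @^-1` U).

Definition abs_continuous (R : realType) (u v : R) (f : R -> R) : Prop :=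
  forall e : R, 0 < e -> exists2 d : R, 0 < d &
    forall (n : nat) (p q : 'I_n -> R),
      (forall i, u <= p i /\ p i <= q i /\ q i <= v) ->
      trivIset setT (fun i => `]p i, q i[%classic) ->
      \sum_(i < n) (q i - p i) < d ->
      \sum_(i < n) `|f (q i) - f (p i)| < e.

Definition loc_abs_continuous (R : realType) (s : R) (f : R -> R) : Prop :=
  forall T : R, s <= T -> abs_continuous s T f.

(* int_u^t b, where b is defined on [0, +oo[ and extended by 0 to the left. *)
Definition integral_from (R : realType) (b : R -> R) (u t : R) : \bar R :=
  (\int[leb R]_(s in `[u, t]) (patch (fun=> 0%R) `[0%R, +oo[ b s)%:E)%E.

(* Only the values of a, b, g, h on [s, +oo[ (s >= 0) and those of phi on
   ]-oo, s] matter. *)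
Definition is_solution (R : realType) (a b g h : R -> R) (s : R)
    (phi x : R -> R) : Prop :=
  let y := fun t : R => x t - a t * x (g t) in
  [/\ lebesgue_measurable_fun setT x,
      loc_ess_bounded s x,
      loc_abs_continuous s y,
      (\forall t \ae leb R, s <= t ->
         derivable y t 1 /\ derive1 y t + b t * x (h t) = 0) &
      forall t : R, t <= s -> x t = phi t].

Definition initial_function (R : realType) (s : R) (phi : R -> R) : Prop :=
  measurable_fun `]-oo, s] phi /\ [bounded phi t | t in `]-oo, s]].

Definition stable (R : realType) (t0 : R) (a b g h : R -> R) : Prop :=
  forall s : R, t0 <= s -> forall e : R, 0 < e ->
  exists2 eta : R, 0 < eta &
    forall phi x : R -> R,
      initial_function s phi -> is_solution a b g h s phi x ->
      (ereal_sup [set `|phi r|%:E | r in `]-oo, s]] < eta%:E)%E ->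
      \forall t \ae leb R, s <= t -> `|x t| < e.

(* Limit at +oo up to a null set: a solution is determined only almost
   everywhere. *)
Definition ess_cvg_pinfty (R : realType) (x : R -> R) (l : R) : Prop :=
  forall e : R, 0 < e ->
  exists T : R, \forall t \ae leb R, T <= t -> `|x t - l| < e.

Definition asymptotically_stable (R : realType) (t0 : R) (a b g h : R -> R) :
    Prop :=
  stable t0 a b g h /\
  forall (s : R) (phi x : R -> R), t0 <= s ->
    initial_function s phi -> is_solution a b g h s phi x ->
    ess_cvg_pinfty x 0.

(* Main.v *)
Require Import Defs.
From HB Require Import structures.
From mathcomp Require Import all_boot all_order all_algebra.
From mathcomp Require Import all_classical all_reals all_analysis.
From mathcomp Require Import measurable_realfun ess_sup_inf ring lra.
Import Order.TTheory GRing.Theory Num.Theory.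
Import numFieldNormedType.Exports.


(** Write [al] for the essential norm of [a], [z t = x t - a t * x (g t)], and
measure time by [B t], the integral of [b] from 0 to [t].  In this time the
equation reads [dz/dB = - x (h t)], and both alternatives of the hypothesis say
that [al < 1/2] and that the delay of [h] is at most
[r = 1/e + (1 - 2 * al)].  No change of variable is made: the proof stays in
the original time and uses test functions that are smooth expressions in [z]
and [B], for which a sign of the derivative almost everywhere gives
monotonicity ([ac_monotone], [lip_nonincreasing]).  That [B] has derivative [b]
almost everywhere is Lebesgue's differentiation theorem, applied to a Borel
function equal to [b] almost everywhere ([borel_version],
[primitive_exists]).

Suppose [|x| <= M].  Then [x (h t)] is within [al * M] of [z (h t)], and since
[|dz/dB| <= M], replacing [h t] by a point [c] at distance at most [1/e] from
[t] costs at most [(r - 1/e) * M = (1 - 2 * al) * M].  So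
[dz/dB <= F - z c] with [F = (1 - al) * M] and a delay of at most [1/e].  This
is the range of delays for which [dz/dB = - z c] does not oscillate: for
[q = exp (e B) (z - F - P)], where the decaying exponential [P] absorbs the
initial data, one finds [dq/dB <= e q(t) - th q(c)] with [1 <= th <= e], which
keeps [q] nonincreasing ([delay_nonincreasing], [overshoot_nonincreasing]).
Hence [z <= F + P].

The bound [F] alone would only return [|x| <= |z| + al * M <= M], because the
delay may come arbitrarily close to [r].  The monotonicity of [q] gives more:
if [z] is close to [F] at some late time, it was already close to [F] during
the preceding [r + 1] units of [B]; then [x (h t)] is at least about
[(1 - 2 * al) * M] during the last unit, so [z] has to decrease by that amount
and cannot be close to [F] at its end.  So [|z| <= (1 - al - eta) * M], and
[|x| <= (1 - eta) * M], after [N] units of [B], with [eta > 0] and [N]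
depending only on [al] and [r] ([delay_contraction]).

For stability, an exponential bound ([growth]) controls the first [N] units of
[B] and the contraction prevents any later growth ([solution_bounded]).  For
attractivity, the eventual bound of [|x|] is multiplied by [1 - eta] again and
again ([solution_vanishes]). *)

Set Implicit Arguments.
Unset Strict Implicit.
Unset Printing Implicit Defensive.

Local Open Scope classical_set_scope.
Local Open Scope ring_scope.

(** * Almost everywhere statements on the line *)

(** The carrier of [leb R] is an alias of [R] on which order and ring
expressions elaborate poorly; quantifying over [R] itself avoids this. *)
Definition ae (R : realType) (P : R -> Prop) : Prop :=
  (leb R).-negligible (~` [set t | P t]).

Lemma ae_all (R : realType) (P : R -> Prop) : (forall t, P t) -> ae P.
Proof. by move=> hP; rewrite /ae; apply: (aeW (leb R)). Qed.

Lemma ae_mono (R : realType) (P Q : R -> Prop) :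
  (forall t, P t -> Q t) -> ae P -> ae Q.
Proof.
move=> PQ; rewrite /ae; apply: negligibleS => t /= nQ /PQ; exact: nQ.
Qed.

Lemma ae_and (R : realType) (P Q : R -> Prop) :
  ae P -> ae Q -> ae (fun t => P t /\ Q t).
Proof.
move=> hP hQ; have := negligibleU hP hQ; apply: negligibleS => t /=.
by move/not_andP.
Qed.

Lemma ae_foralln (R : realType) (P : nat -> R -> Prop) :
  (forall n, ae (P n)) -> ae (fun t => forall n, P n t).
Proof.
move=> hP; have := negligible_bigcup hP; apply: negligibleS => t /=.
by move/existsNP => [n hn]; exists n.
Qed.


Lemma leb_set1 (R : realType) (c : R) : leb R [set c] = 0%E.
Proof. by rewrite -[LHS](_ : @lebesgue_measure R [set c] = _)// lebesgue_measure_set1. Qed.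

(** Null sets have open neighbourhoods of small length, since the completed
measure is the outer measure generated by the lengths of intervals. *)
Lemma ae_outer (R : realType) (P : R -> Prop) (d : R) : ae P -> 0 < d ->
  exists U : set R, [/\ open U, ~` [set t | P t] `<=` U &
    (@lebesgue_measure R U < d%:E)%E].
Proof.
move=> [A [mA A0 PA]] d0.
have d20 : 0 < d / 2 by rewrite divr_gt0.
have [U [oU AU mU]] := outer_measure_open_le A d20.
exists U; split => //; first exact: subset_trans PA AU.
apply: (le_lt_trans mU).
have -> : ((@wlength R idfun)^*%mu A = 0)%E by exact: A0.
by rewrite add0e lte_fin ltr_pdivrMr// mulr2n mulrDr mulr1 ltrDl.
Qed.

Lemma ae_neq (R : realType) (c : R) : ae (fun t => t != c).
Proof.
exists [set c]; split; last by move=> t /= /negP; rewrite negbK => /eqP.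
- apply: (@sub_caratheodory _ (ocitv_type R) R (@wlength R idfun)).
  exact: measurable_set1.
- exact: leb_set1.
Qed.

Lemma ae_exists (R : realType) (P : R -> Prop) (u : R) : ae P ->
  exists2 t, u <= t & P t.
Proof.
move=> aeP; apply: contrapT => nP.
have [U [oU PU]] := ae_outer aeP (ltr01 : 0 < 1 :> R).
apply/negP; rewrite -leNgt.
have <- : @lebesgue_measure R `[u, u + 1]%classic = 1%:E.
  by rewrite lebesgue_measure_itv/= lte_fin ltrDl ltr01 -EFinB addrAC subrr add0r.
apply: le_measure; rewrite ?inE//; first exact: open_measurable.
move=> t /=; rewrite in_itv/= => /andP[ut _]; apply: PU => Pt.
by apply: nP; exists t.
Qed.

(** * Absolutely continuous functions with nonpositive derivative *)

Section monotone.
Variables (R : realType) (f : R -> R) (u v : R).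
Implicit Types (U : set R) (s : seq (R * R)) (t : R).

(** The intervals of a chain are listed from right to left, so that the
supremum argument below extends a chain at its head. *)
Fixpoint chain U t s : Prop :=
  if s is (p, q) :: s' then
    [/\ q <= t, p <= q, `[p, q]%classic `<=` U & chain U p s']
  else u <= t.

Lemma chain_ge U t s : chain U t s -> u <= t.
Proof.
elim: s t => [//|[p q] s IH] t /= [qt pq _ /IH up].
exact: le_trans up (le_trans pq qt).
Qed.

Lemma chain_widen U t t' s : t <= t' -> chain U t s -> chain U t' s.
Proof.
case: s => [|[p q] s] /= tt'; first by move=> /le_trans; apply.
by case=> qt pq pqU c; split => //; exact: le_trans tt'.
Qed.

Lemma chain_nth U t s i : chain U t s -> (i < size s)%N ->
  [/\ u <= (nth (0, 0) s i).1, (nth (0, 0) s i).1 <= (nth (0, 0) s i).2 &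
     (nth (0, 0) s i).2 <= t].
Proof.
elim: s t i => [//|[p q] s IH] t [|i] /= [qt pq _ c] si.
  by split => //; exact: chain_ge c.
by have [h1 h2 h3] := IH p i c si; split => //; lra.
Qed.

Lemma chain_order U t s i j : chain U t s -> (i < j)%N -> (j < size s)%N ->
  (nth (0, 0) s j).2 <= (nth (0, 0) s i).1.
Proof.
elim: s t i j => [//|[p q] s IH] t [|i] [|j] //= [qt pq _ c] ij sj.
  by have [] := chain_nth c sj.
exact: (IH p i j c).
Qed.

(** The intervals are pairwise disjoint up to endpoints, so their total length is at
most the measure of the part of [U] up to [t]. *)
Lemma chain_length U t s : measurable U -> chain U t s ->
  ((\sum_(w <- s) (w.2 - w.1))%:E <=
    @lebesgue_measure R (U `&` `]-oo, t]))%E.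
Proof.
move=> mU; elim: s t => [|[p q] s IH] t /=.
  by move=> _; rewrite big_nil measure_ge0.
move=> [qt pq pqU c]; rewrite big_cons/=.
have mpq : measurable (`]p, q]%classic : set R) by exact: measurable_itv.
have lpq : @lebesgue_measure R `]p, q]%classic = (q - p)%:E.
  rewrite lebesgue_measure_itv/= lte_fin.
  by case: ltgtP pq => // -> _; rewrite subrr.
have mUp : measurable (U `&` `]-oo, p] : set R).
  by apply: measurableI => //; exact: measurable_itv.
apply: (@le_trans _ _ (@lebesgue_measure R (`]p, q]%classic `|` (U `&` `]-oo, p])))).
  rewrite measureU//.
    rewrite EFinD leeD//; last exact: (IH p c).
    by rewrite -lpq.
  apply/seteqP; split => // r /= [] /[swap] -[_].
  by rewrite !in_itv/= => rp /andP[/lt_le_trans/(_ rp)]; rewrite ltxx.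
apply: le_measure; rewrite ?inE; try by [exact: measurableU|apply: measurableI => //; exact: measurable_itv].
move=> r /= []; rewrite !in_itv/=.
  move=> /andP[pr rq]; split; last exact: le_trans qt.
  by apply: pqU; rewrite /= in_itv/= (ltW pr).
by move=> [Ur rp]; split => //; have := chain_ge c; lra.
Qed.

(** Cover the exceptional null set by an open [U] of small measure.  Moving
from [u] to the right, the increase of [f] is at most [e] times the distance
outside [U], thanks to the derivative, and inside [U] it is paid for by the
variation of [f] on a chain of intervals of [U], which absolute continuity
makes smaller than [e].  The set [S] of points reached with this estimate
contains its supremum and cannot stop before [v]. *)
Lemma ac_monotone : u <= v -> abs_continuous u v f ->
  ae (fun t => u < t < v -> exists2 d, is_derive t 1 f d & d <= 0) ->
  f v <= f u.
Proof.
move=> uv fac fd.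
have fd' : ae (fun t => t != u /\ t != v /\
    (u < t < v -> exists2 d, is_derive t 1 f d & d <= 0)).
  by apply: ae_and; [exact: ae_neq|apply: ae_and => //; exact: ae_neq].
suff H e : 0 < e -> f v - f u <= e * (v - u) + e.
  rewrite -subr_le0; apply/ler_addgt0Pr => e e0.
  have k0 : 0 < v - u + 1 by lra.
  have := H (e / (v - u + 1)) (divr_gt0 e0 k0).
  by rewrite -{2}[e / _]mulr1 -mulrDr divfK ?add0r// gt_eqF.
move=> e0; have [d d0 fde] := fac _ e0.
have [U [oU PU mUd]] := ae_outer fd' d0.
have mU : measurable U by exact: open_measurable.
pose S := [set t | t <= v /\ exists2 s, chain U t s &
  f t - f u <= e * (t - u) +
    \sum_(w <- s) `|f w.2 - f w.1|].
have Su : S u.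
  by split => //; exists [::] => //=; rewrite big_nil !subrr mulr0 addr0.
have Sge t : S t -> u <= t by move=> [_ [s /chain_ge]].
suff [_ [s cs fs]] : S v.
  apply: (le_trans fs); rewrite lerD2l; apply: ltW.
  rewrite (big_nth (0, 0)) big_mkord.
  apply: (fde _ (fun i => (nth (0, 0) s i).1) (fun i => (nth (0, 0) s i).2)).
  - by move=> i; have [] := chain_nth cs (ltn_ord i).
  - apply/trivIsetP => i j _ _ ij; apply/seteqP; split => // r [] /=.
    rewrite !in_itv/= => /andP[i1 i2] /andP[j1 j2].
    have [ij'|ji|/ord_inj/eqP] := ltngtP i j; last by rewrite (negbTE ij).
      by have := chain_order cs ij' (ltn_ord j); lra.
    by have := chain_order cs ji (ltn_ord i); lra.
  - rewrite -(big_mkord xpredT (fun i => (nth (0, 0) s i).2 - (nth (0, 0) s i).1)).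
    rewrite -(big_nth (0, 0) xpredT (fun w => w.2 - w.1)).
    rewrite -lte_fin; apply: le_lt_trans mUd; apply: (le_trans (chain_length mU cs)).
    by apply: le_measure; rewrite ?inE//; apply: measurableI => //; exact: measurable_itv.
have hS : has_sup S by split; [exists u|exists v => t []].
set m := sup S.
have um : u <= m by apply: ub_le_sup => //; case: hS.
have mv : m <= v by apply: ge_sup; [exists u|move=> t []].
have step : exists2 r, 0 < r & forall t t', m - r < t -> t <= m -> m <= t' ->
    t' < m + r -> t' <= v -> S t -> S t'.
  (* either [m] lies in [U] and one interval of [U] is added to the chain, or
     [f] is derivable at [m] and the same chain serves on both sides of [m] *)
  have [mU'|nmU] := pselect (U m).
    have /nbhs_ballP[r /= r0 rU] : nbhs m U by exact: open_nbhs_nbhs.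
    exists r => // t t' rt tm mt' t'r t'v [tv [s cs fs]]; split => //.
    exists ((t, t') :: s).
      split => //; first lra.
      move=> w /=; rewrite in_itv/= => /andP[tw wt']; apply: rU.
      by rewrite /ball/= ltr_distl; lra.
    rewrite big_cons/=.
    have h1 := ler_norm (f t' - f t).
    have h2 : e * (t - u) <= e * (t' - u) by rewrite ler_pM2l//; lra.
    lra.
  have [mu [mv' fdm]] : m != u /\ m != v /\
    (u < m < v -> exists2 d, is_derive m 1 f d & d <= 0).
    by apply: contrapT => /PU.
  have umv : u < m < v by rewrite !lt_neqAle eq_sym mu um mv' mv.
  have [l [fm lE] l0] := fdm umv.
  have : h^-1 *: ((f \o shift m) (h *: (1 : R)) - f m) @[h --> 0^'] --> l.
    have /cvg_ex[l' cl'] := fm.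
    by move: lE; rewrite /derive (cvg_lim _ cl')// => <-.
  move=> /cvgrPdist_lt/(_ e e0)[r /= r0 hr].
  exists r => // t t' rt tm mt' t'r t'v [tv [s cs fs]]; split => //.
  exists s; first by apply: chain_widen cs; lra.
  suff : f t' - f t <= e * (t' - t) by lra.
  have key w : w != m -> `|w - m| < r -> (f w - f m) / (w - m) < l + e.
    move=> wm wr; have := hr (w - m).
    rewrite /ball_/= sub0r normrN => /(_ wr).
    rewrite subr_eq0 => /(_ wm); rewrite /GRing.scale/= mulr1 subrK ltr_distlC => /andP[_].
    by rewrite mulrC.
  have h1 : f t' - f m <= e * (t' - m).
    have [->|t'm] := eqVneq t' m; first by rewrite !subrr mulr0.
    have tm0 : 0 < t' - m by rewrite subr_gt0 lt_neqAle eq_sym t'm.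
    have : `|t' - m| < r by rewrite gtr0_norm//; lra.
    move=> /(key _ t'm); rewrite ltr_pdivrMr// => /ltW/le_trans; apply.
    by rewrite ler_pM2r//; lra.
  have h2 : f m - f t <= e * (m - t).
    have [->|t'm] := eqVneq t m; first by rewrite !subrr mulr0.
    have tm0 : 0 < m - t by rewrite subr_gt0 lt_neqAle t'm.
    have : `|t - m| < r by rewrite distrC gtr0_norm//; lra.
    move=> /(key _ t'm); rewrite -[f t - _]opprB -[t - m]opprB invrN mulrNN.
    rewrite ltr_pdivrMr// => /ltW/le_trans; apply.
    by rewrite ler_pM2r//; lra.
  lra.
have [r r0 stepr] := step.
have [t St mrt] : exists2 t, S t & m - r < t by exact: sup_adherent.
have tm : t <= m by apply: ub_le_sup => //; case: hS.
have Sm : S m by apply: (stepr t m) => //; lra.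
have [->//|mnv] := eqVneq v m.
have mltv : m < v by rewrite lt_neqAle eq_sym mnv.
pose t' := Num.min (m + r / 2) v.
have t'v : t' <= v by rewrite ge_min lexx orbT.
have t'r : t' < m + r by rewrite gt_min; apply/orP; left; lra.
have mt' : m < t' by rewrite lt_min mltv andbT; lra.
have St' : S t' by apply: (stepr m t') => //; lra.
have : t' <= m by apply: ub_le_sup => //; case: hS.
by rewrite leNgt mt'.
Qed.

End monotone.

(** * Lipschitz functions and derivatives *)

Section calculus.
Variable R : realType.
Implicit Types (f g : R -> R) (u v s t k : R).

Definition lip u v f := exists2 K, 0 <= K &
  forall s t, u <= s -> s <= t -> t <= v -> `|f t - f s| <= K * (t - s).

Lemma lip_ac u v f : lip u v f -> abs_continuous u v f.
Proof.
move=> [K K0 fK] e e0; exists (e / (K + 1)); first by rewrite divr_gt0// ltr_wpDl.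
move=> n p q pq _ sd.
have K1 : 0 < K + 1 by rewrite ltr_wpDl.
apply: (@le_lt_trans _ _ (\sum_(i < n) (K + 1) * (q i - p i))).
  apply: ler_sum => i _; have [h1 [h2 h3]] := pq i.
  apply: (le_trans (fK _ _ h1 h2 h3)); rewrite ler_wpM2r ?subr_ge0//; lra.
by rewrite -mulr_sumr mulrC -ltr_pdivlMr.
Qed.

Lemma lip_sub u v u' v' f : u <= u' -> v' <= v -> lip u v f -> lip u' v' f.
Proof.
move=> uu vv [K K0 fK]; exists K => // s t us st tv.
by apply: fK => //; [exact: le_trans us|exact: le_trans vv].
Qed.

Lemma lip_bounded u v f : u <= v -> lip u v f ->
  exists2 K, 0 <= K & forall t, u <= t -> t <= v -> `|f t| <= K.
Proof.
move=> uv [K K0 fK]; exists (`|f u| + K * (v - u)).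
  by rewrite addr_ge0// mulr_ge0// subr_ge0.
move=> t ut tv; have := fK u t (lexx _) ut tv.
have : K * (t - u) <= K * (v - u) by rewrite ler_wpM2l// lerD2r.
by have := ler_normD (f t - f u) (f u); rewrite subrK; lra.
Qed.

Lemma lip_cst u v k : lip u v (fun=> k).
Proof. by exists 0 => // s t _ st _; rewrite subrr normr0 mul0r. Qed.

Lemma lipD u v f g : lip u v f -> lip u v g -> lip u v (fun t => f t + g t).
Proof.
move=> [K K0 fK] [L L0 gL]; exists (K + L); first exact: addr_ge0.
move=> s t us st tv; rewrite opprD addrACA mulrDl.
by apply: (le_trans (ler_normD _ _)); rewrite lerD ?fK ?gL.
Qed.

Lemma lipM u v f g : u <= v -> lip u v f -> lip u v g ->
  lip u v (fun t => f t * g t).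
Proof.
move=> uv lf lg; have [a a0 fa] := lip_bounded uv lf.
have [c c0 gc] := lip_bounded uv lg.
move: lf lg => [K K0 fK] [L L0 gL]; exists (a * L + c * K).
  by rewrite addr_ge0// mulr_ge0.
move=> s t us st tv.
have -> : f t * g t - f s * g s = f t * (g t - g s) + g s * (f t - f s) by ring.
apply: (le_trans (ler_normD _ _)); rewrite mulrDl !normrM -!mulrA lerD//.
  by apply: ler_pM => //; [apply: fa => //; lra|exact: gL].
by apply: ler_pM => //; [apply: gc => //; lra|exact: fK].
Qed.

Lemma lipN u v f : lip u v f -> lip u v (fun t => - f t).
Proof.
by move=> [K K0 fK]; exists K => // s t us st tv; rewrite -opprD normrN fK.
Qed.

Lemma expRB_le (x y : R) : expR y - expR x <= expR y * (y - x).
Proof.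
have := expR_ge1Dx (x - y); rewrite expRD expRN => h.
have e0 := expR_gt0 y.
have : expR y * (1 + (x - y)) <= expR y * (expR x / expR y) by rewrite ler_pM2l.
by rewrite mulrCA divff ?mulr1 ?gt_eqF//; lra.
Qed.

Lemma lip_expR u v f : u <= v -> lip u v f -> lip u v (fun t => expR (f t)).
Proof.
move=> uv lf; have [a a0 fa] := lip_bounded uv lf.
move: lf => [K K0 fK]; exists (expR a * K).
  by rewrite mulr_ge0// expR_ge0.
move=> s t us st tv; rewrite -mulrA.
have bnd w : u <= w -> w <= v -> expR (f w) <= expR a.
  by move=> uw wv; rewrite ler_expR; apply: (le_trans (ler_norm _)); exact: fa.
have key x y : u <= x -> x <= v -> expR (f x) * (f x - f y) <= expR a * `|f x - f y|.
  move=> ux xv; apply: (@le_trans _ _ (expR (f x) * `|f x - f y|)).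
    by rewrite ler_pM2l ?expR_gt0// ler_norm.
  by rewrite ler_wpM2r// bnd.
have h1 := expRB_le (f s) (f t); have h2 := expRB_le (f t) (f s).
have k1 := key t s (le_trans us st) tv; have k2 := key s t us (le_trans st tv).
rewrite distrC in k2.
apply: (@le_trans _ _ (expR a * `|f t - f s|)).
  by rewrite ler_norml; lra.
by rewrite ler_pM2l ?expR_gt0// fK.
Qed.

Lemma derD t f g df dg : is_derive t 1 f df -> is_derive t 1 g dg ->
  is_derive t 1 (fun t => f t + g t) (df + dg).
Proof. by move=> hf hg; exact: (@is_deriveD _ _ _ f g). Qed.

Lemma derN t f df : is_derive t 1 f df -> is_derive t 1 (fun t => - f t) (- df).
Proof. by move=> hf; exact: (@is_deriveN _ _ _ f). Qed.

Lemma derM t f g df dg : is_derive t 1 f df -> is_derive t 1 g dg ->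
  is_derive t 1 (fun t => f t * g t) (df * g t + f t * dg).
Proof.
move=> hf hg; have := is_deriveM hf hg.
by rewrite /GRing.scale/= addrC [g t * _]mulrC.
Qed.

Lemma der_cst t k : is_derive t 1 (fun=> k) 0.
Proof. exact: is_derive_cst. Qed.

Lemma derZ t k f df : is_derive t 1 f df -> is_derive t 1 (fun t => k * f t) (k * df).
Proof.
by move=> hf; have := derM (der_cst t k) hf; rewrite mul0r add0r.
Qed.

Lemma der_expR t f df : is_derive t 1 f df ->
  is_derive t 1 (fun t => expR (f t)) (df * expR (f t)).
Proof.
move=> hf; have := is_derive1_comp (is_derive_expR (f t)) hf.
by rewrite mulrC.
Qed.

Lemma lip_nonincreasing u v f : lip u v f ->
  ae (fun t => u < t < v -> exists2 d, is_derive t 1 f d & d <= 0) ->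
  forall s t, u <= s -> s <= t -> t <= v -> f t <= f s.
Proof.
move=> lf fd s t us st tv; apply: ac_monotone => //.
  exact/lip_ac/(lip_sub us tv).
by apply: ae_mono fd => r + /andP[sr rt]; apply; lra.
Qed.

(** The way every iteration below is concluded: an error term divided by a
fixed factor at each round disappears. *)
Lemma geometric_vanish (a c X rho : R) : 0 <= rho -> rho < 1 ->
  (forall n, a <= c + X * rho ^+ n) -> a <= c.
Proof.
move=> r0 r1 H.
have cv : (fun n => c + X * rho ^+ n) @ \oo --> c.
  rewrite -[X in _ --> X]addr0; apply: cvgD; first exact: cvg_cst.
  by apply: cvg_geometric; rewrite ger0_norm.
rewrite -(cvg_lim _ cv)//; apply: limr_ge; first exact: cvgP cv.
exact: nearW.
Qed.

End calculus.

(** * Borel versions and primitives of Lebesgue measurable functions *)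

Lemma borel_lebesgue (R : realType) (A : set R) : measurable A ->
  measurable (A : set (lebesgueT R)).
Proof. exact: (@sub_caratheodory _ (ocitv_type R) R (@wlength R idfun)). Qed.

Lemma ae_borel (R : realType) (P : R -> Prop) :
  {ae @lebesgue_measure R, forall t, P t} -> ae P.
Proof. by move=> [A [mA A0 PA]]; exists A; split => //; exact: borel_lebesgue. Qed.


Lemma measurable_borel_lebesgue (R : realType) (D : set R) (f : R -> R) :
  measurable D -> measurable_fun D f -> lebesgue_measurable_fun D f.
Proof.
by move=> mD mf _ Y mY; apply: borel_lebesgue; exact: mf.
Qed.

Lemma integral_borel_lebesgue (R : realType) (D : set R) (f : R -> R) :
  measurable D -> measurable_fun D f -> (forall t, 0 <= f t) ->
  (\int[leb R]_(t in D) (f t)%:E = \int[@lebesgue_measure R]_(t in D) (f t)%:E)%E.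
Proof.
move=> mD mf f0.
have mid : measurable_fun setT (idfun : lebesgueT R -> measurableTypeR R).
  by move=> _ Y mY; rewrite setTI; exact: borel_lebesgue.
have := @ge0_integral_pushforward _ _ (lebesgueT R) (measurableTypeR R) R _ mid
  (leb R) D (EFin \o f) mD.
move=> <-//; last by move=> t _; rewrite lee_fin.
exact/measurable_EFinP.
Qed.

(** For each rational [q], the set where [c] exceeds [q] contains a Borel set of
full measure in it, the Caratheodory sets being the completion of the Borel
sets.  The supremum of the rationals [q] over these Borel sets is Borel, at
most [c], and equal to [c] off a countable union of null sets. *)
Lemma borel_version (R : realType) (c : R -> R) (M : R) :
  lebesgue_measurable_fun setT c -> (forall t, 0 <= c t <= M) ->
  exists f : R -> R, [/\ measurable_fun setT f,
    forall t, 0 <= f t <= c t & ae (fun t => f t = c t)].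
Proof.
move=> mc c0M.
pose q n : R := if (unpickle n : option rat) is Some r then ratr r else 0.
have H n : exists A : set R, [/\ measurable A, A `<=` [set t | q n < c t] &
    ae (fun t => q n < c t -> A t)].
  have : measurable ([set t | q n < c t] : set (lebesgueT R)).
    rewrite (_ : [set _ | _] = setT `&` c @^-1` `]q n, +oo[).
      by apply: mc => //; exact: measurable_itv.
    by apply/seteqP; split => t /=; rewrite in_itv/= andbT//; case.
  move=> /= mE.
  have : (completed_algebra_gen (@lebesgue_measure R)) [set t | q n < c t].
    by rewrite -g_sigma_completed_algebra_genE completed_caratheodory_measurable.
  move=> [A mA [N nN AN]]; exists A; split => //.
    by rewrite -AN; exact: subsetUl.
  apply: ae_borel; apply: negligibleS nN => t /= /not_implyP[qc nA].
  have : (A `|` N) t by rewrite AN.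
  by case.
pose A n := projT1 (cid (H n)).
have mA n : measurable (A n) by rewrite /A; case: cid => ? [].
have Ac n t : A n t -> q n < c t by rewrite /A; case: cid => ? [] ? + ? /=; exact.
have aeA n : ae (fun t => q n < c t -> A n t) by rewrite /A; case: cid => ? [].
pose g n t := Num.max 0 (q n) * \1_(A n) t.
have g0 n t : 0 <= g n t by rewrite mulr_ge0// ?le_max ?lexx// indicE.
have gc n t : g n t <= c t.
  rewrite /g indicE; case: (boolP (t \in A n)) => tA; rewrite ?mulr1 ?mulr0; have /andP[c0 _] := c0M t => //.
  by rewrite ge_max c0/=; apply/ltW/Ac; exact: set_mem.
exists (fun t => sups (g ^~ t) 0%N); split.
- apply: measurable_fun_sups.
    by move=> t _; exists (c t) => _ [n _ <-]; exact: gc.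
  by move=> n; apply: measurable_funM => //; exact: measurable_indic.
- move=> t; apply/andP; split.
    apply: (le_trans (g0 0%N t)); apply: ub_le_sup; last by exists 0%N.
    by exists (c t) => _ [n _ <-]; exact: gc.
  apply: ge_sup; first by exists (g 0%N t); exists 0%N.
  by move=> _ [n _ <-]; exact: gc.
- apply: ae_mono (ae_foralln aeA) => t tA.
  have sc : sups (g ^~ t) 0%N <= c t.
    apply: ge_sup; first by exists (g 0%N t); exists 0%N.
    by move=> _ [n _ <-]; exact: gc.
  apply/eqP; rewrite eq_le sc/= leNgt; apply/negP => /rat_in_itvoo[r].
  rewrite in_itv/= => /andP[sr rc].
  have := tA (pickle r); rewrite {1}/q pickleK => /(_ rc) At.
  have : g (pickle r) t <= sups (g ^~ t) 0%N.
    apply: ub_le_sup; last by exists (pickle r).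
    by exists (c t) => _ [n _ <-]; exact: gc.
  rewrite leNgt => /negP; apply; apply: (lt_le_trans sr).
  by rewrite /g indicE mem_set// mulr1 /q pickleK le_max lexx orbT.
Qed.

Lemma primitive_exists (R : realType) (c : R -> R) (M : R) :
  lebesgue_measurable_fun setT c -> (forall t, 0 <= c t <= M) ->
  (forall t : R, t < 0 -> c t = 0) ->
  exists B : R -> R, [/\ forall u t, u <= t -> 0 <= B t - B u <= M * (t - u),
    ae (fun t => is_derive t 1 B (c t)) &
    forall u t, u <= t -> (\int[leb R]_(r in `[u, t]) (c r)%:E = (B t - B u)%:E)%E].
Proof.
move=> mc c0M cneg; have [f [mf fc aef]] := borel_version mc c0M.
have itvfin b1 b2 u t :
    (@lebesgue_measure R [set` Interval (BSide b1 u) (BSide b2 t)] < +oo)%E.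
  by rewrite lebesgue_measure_itv/=; case: ifP => // _; rewrite -EFinB ltry.
have f0 t : 0 <= f t by have /andP[] := fc t.
have fM t : f t <= M.
  by have /andP[_ /le_trans] := fc t; apply; have /andP[] := c0M t.
have mf' D : measurable_fun D f by exact: measurable_funS mf.
have fneg : f \_ `[0, +oo[ = f.
  apply/funext => t; rewrite patchE; case: ifPn => //.
  rewrite notin_setE/= in_itv/= andbT => /negP; rewrite -ltNge => t0.
  have -> // : f t = 0.
  by apply/eqP; rewrite eq_le f0 andbT -[leRHS](cneg _ t0); have /andP[] := fc t.
have intb (D : set R) : measurable D -> (@lebesgue_measure R D < +oo)%E ->
    (@lebesgue_measure R).-integrable D (EFin \o f).
  move=> mD Dfin; apply: measurable_bounded_integrable => //.
    exact: mf'.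
  by exists M; split; [exact: num_real|move=> x Mx t _; rewrite /= ger0_norm// (le_trans (fM t))// ltW].
have intf y : (@lebesgue_measure R).-integrable `]-oo, y] (EFin \o f).
  rewrite -fneg -restrict_EFin; apply/integrable_restrict => //.
  apply: intb; first exact: measurableI.
  apply: (@le_lt_trans _ _ (@lebesgue_measure R `[0, Num.max 0 y]%classic)).
    apply: le_measure; rewrite ?inE//; first exact: measurableI.
    move=> r [] /=; rewrite !in_itv/= andbT => ry -> /=.
    by rewrite le_max ry orbT.
  exact: itvfin.
pose B y := (\int[@lebesgue_measure R]_(t in `]-oo, y]) f t)%R.
have BE u t : u <= t -> B t - B u = \int[@lebesgue_measure R]_(r in `[u, t]) f r.
  move=> ut; rewrite /B Rintegral_itvB// ?bnd_simp//.
  rewrite Rintegral_itv_obnd_cbnd//; apply: intb; first exact: measurable_itv.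
  exact: itvfin.
have intut u t : (@lebesgue_measure R).-integrable `[u, t] (EFin \o f).
  apply: intb; first exact: measurable_itv.
  exact: itvfin.
exists B; split.
- move=> u t ut; rewrite BE//; apply/andP; split; first exact: Rintegral_ge0.
  apply: (@le_trans _ _ (\int[@lebesgue_measure R]_(r in `[u, t]) M)).
    apply: le_Rintegral => //.
    apply: (@measurable_bounded_integrable _ _ _ _ (fun=> M)) => //.
      exact: itvfin.
    by exists M; split; [exact: num_real|move=> x Mx r _ /=; rewrite ger0_norm; [exact: ltW|exact: le_trans (f0 0) (fM 0)]].
  have lut : @lebesgue_measure R `[u, t]%classic = (t - u)%:E.
    rewrite lebesgue_measure_itv/= lte_fin.
    by case: ltgtP ut => // -> _; rewrite subrr.
  by rewrite Rintegral_cst//= lut.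
- have locf : locally_integrable [set: R] f.
    split => //; first exact: openT.
    move=> K _ cK.
    by have /integrableP[] := intb K (compact_measurable cK) (compact_finite_measure cK).
  have /ae_borel h := FTC1Ny intf locf.
  apply: ae_mono (ae_and h aef) => t [[dB dBE] <-].
  by apply: (DeriveDef dB); rewrite -derive1E dBE.
- move=> u t ut; rewrite BE//.
  transitivity (\int[leb R]_(r in `[u, t]) (f r)%:E)%E.
    have mI : measurable (`[u, t]%classic : set (lebesgueT R)).
      by apply: borel_lebesgue; exact: measurable_itv.
    apply: ge0_ae_eq_integral; first exact: mI.
    + apply/measurable_EFinP; apply: measurable_funS mc => //.
    + apply/measurable_EFinP; exact: measurable_borel_lebesgue.
    + by move=> x _; rewrite lee_fin; have /andP[] := c0M x.
    + by move=> x _; rewrite lee_fin.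
    + by apply: ae_mono aef => x -> _.
  rewrite integral_borel_lebesgue// /Rintegral fineK//.
  by apply: integrable_fin_num => //; exact: intut.
Qed.

(** * Time measured by a nondecreasing Lipschitz function *)

Section clock.
Variable R : realType.
Implicit Types (B b z xi h : R -> R) (u v s t : R).

Definition clock B (beta : R) :=
  forall u t, u <= t -> 0 <= B t - B u <= beta * (t - u).

Lemma clock_mono B beta : clock B beta -> forall u t, u <= t -> B u <= B t.
Proof. by move=> cB u t /cB/andP[]; rewrite subr_ge0. Qed.

Lemma clock_lip B beta u v : clock B beta -> lip u v B.
Proof.
move=> cB; exists (Num.max 0 beta); first by rewrite le_max lexx.
move=> s t _ st _; have /andP[h1 h2] := cB _ _ st.
rewrite ger0_norm//; apply: (le_trans h2).
by rewrite ler_wpM2r ?subr_ge0// le_max lexx orbT.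
Qed.

(** Used to find the point lying a prescribed amount of [B]-time before a given
one. *)
Lemma clock_ivt B beta u v y : clock B beta -> u <= v -> B u <= y -> y <= B v ->
  exists c, [/\ u <= c, c <= v & B c = y].
Proof.
move=> cB uv By yB.
have cont : continuous B.
  move=> t; apply/cvgrPdist_lt => e e0.
  have b0 : 0 < `|beta| + 1 by rewrite ltr_wpDl.
  have key s w : s <= w -> `|s - w| < e / (`|beta| + 1) -> B w - B s < e.
    move=> sw; rewrite distrC ger0_norm ?subr_ge0// ltr_pdivlMr// => H.
    have /andP[_ h2] := cB _ _ sw; apply: (le_lt_trans h2).
    apply: le_lt_trans H; rewrite mulrC ler_wpM2l ?subr_ge0//.
    by have := ler_norm beta; lra.
  near=> s.
  have st : `|t - s| < e / (`|beta| + 1).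
    by near: s; apply: cvgr_dist_lt => //; exact: divr_gt0.
  have [ts|/ltW ts] := leP t s.
    have /andP[h1 _] := cB _ _ ts.
    by rewrite distrC ger0_norm//; apply: key.
  have /andP[h1 _] := cB _ _ ts.
  by rewrite ger0_norm//; apply: key => //; rewrite distrC.
have [||c] := @IVT R B u v y uv.
- exact: continuous_subspaceT.
- by rewrite ge_min By/= le_max yB orbT.
by rewrite in_itv/= => /andP[uc cv] <-; exists c.
Unshelve. all: by end_near. Qed.

End clock.

Section absolutely_continuous.
Variable R : realType.
Implicit Types (f z B b xi : R -> R) (u v : R).

Lemma ac_sub u v u' v' f : u <= u' -> v' <= v ->
  abs_continuous u v f -> abs_continuous u' v' f.
Proof.
move=> uu vv fac e /fac[d d0 H]; exists d => // n p q pq; apply: H => i.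
by have [h1 [h2 h3]] := pq i; split; [lra|split; lra].
Qed.

Lemma acD u v f z : abs_continuous u v f -> abs_continuous u v z ->
  abs_continuous u v (fun t => f t + z t).
Proof.
move=> fac zac e e0; have e20 : 0 < e / 2 by lra.
have [d d0 H] := fac _ e20; have [d' d'0 H'] := zac _ e20.
exists (Num.min d d'); first by rewrite lt_min d0.
move=> n p q pq tr; rewrite lt_min => /andP[sd sd'].
apply: (@le_lt_trans _ _ (\sum_(i < n) (`|f (q i) - f (p i)| + `|z (q i) - z (p i)|))).
  by apply: ler_sum => i _; rewrite opprD addrACA ler_normD.
by rewrite big_split/=; have := H n p q pq tr sd; have := H' n p q pq tr sd'; lra.
Qed.

Lemma acN u v f : abs_continuous u v f -> abs_continuous u v (fun t => - f t).
Proof.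
move=> fac e /fac[d d0 H]; exists d => // n p q pq tr sd.
by under eq_bigr do rewrite -opprD normrN; exact: H.
Qed.

(** A function whose derivative with respect to [B] is bounded by [M] cannot
outgrow [M * B]; so [z], which is only known to be absolutely continuous for a
solution, is Lipschitz. *)
Lemma ac_lip B beta b xi z u v M : clock B beta -> 0 <= M ->
  abs_continuous u v z ->
  ae (fun t => u < t < v -> [/\ 0 <= b t, is_derive t 1 B (b t),
    is_derive t 1 z (- (b t * xi t)) & `|xi t| <= M]) ->
  lip u v z.
Proof.
move=> cB M0 zac H; exists (M * Num.max 0 beta).
  by rewrite mulr_ge0// le_max lexx.
move=> s t us st tv.
have lMB : abs_continuous s t (fun w => - (M * B w)).
  by apply/lip_ac/lipN/lipM => //; [exact: lip_cst|exact: clock_lip cB].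
have zst : abs_continuous s t z by exact: ac_sub zac.
have up : z t - M * B t <= z s - M * B s.
  apply: (@ac_monotone _ (fun w => z w - M * B w)) => //; first exact: acD.
  apply: ae_mono H => w H /andP[sw wt].
  have [|b0 dB dz xiM] := H; first by apply/andP; split; lra.
  exists (- (b w * xi w) - M * b w).
    exact: (derD dz (derN (derZ M dB))).
  have : b w * (- xi w) <= b w * M.
    by rewrite ler_wpM2l//; move: xiM; rewrite ler_norml; lra.
  lra.
have dn : - z t - M * B t <= - z s - M * B s.
  apply: (@ac_monotone _ (fun w => - z w - M * B w)) => //.
    by apply: acD => //; exact: acN.
  apply: ae_mono H => w H /andP[sw wt].
  have [|b0 dB dz xiM] := H; first by apply/andP; split; lra.
  exists (- - (b w * xi w) - M * b w).
    exact: (derD (derN dz) (derN (derZ M dB))).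
  have : b w * xi w <= b w * M.
    by rewrite ler_wpM2l//; move: xiM; rewrite ler_norml; lra.
  lra.
have /andP[_ h2] := cB _ _ st.
have h3 : M * (B t - B s) <= M * (Num.max 0 beta * (t - s)).
  rewrite ler_wpM2l// (le_trans h2)// ler_wpM2r ?subr_ge0//.
  by rewrite le_max lexx orbT.
by rewrite ler_norml; lra.
Qed.

End absolutely_continuous.

(** * Comparison for delays of at most 1/e *)

Section delay.
Variable R : realType.
Implicit Types (B b q z xi h : R -> R) (u v s t : R).

(** As [k * q t - th * q c = (k - th) * q t + th * (q t - q c)], an upper bound
[G] of all increments of [q] up to [t], hence of [q t] itself because
[q u <= 0], yields [dq/dB <= k * G].  For [G] proportional to
[expR (2 * k * B)] integration gains a factor [1/2]; iterating, no increment
of [q] is positive. *)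
Lemma delay_nonincreasing B b q u v k :
  u <= v -> 0 < k -> lip u v B -> lip u v q ->
  (forall s t, u <= s -> s <= t -> t <= v -> B s <= B t) ->
  q u <= 0 ->
  ae (fun t => u < t < v -> [/\ 0 <= b t, is_derive t 1 B (b t) &
    exists2 d, is_derive t 1 q d & d <= 0 \/
      exists c th, [/\ u <= c, c <= t, 1 <= th, th <= k &
         d <= b t * (k * q t - th * q c)]]) ->
  forall s t, u <= s -> s <= t -> t <= v -> q t <= q s.
Proof.
move=> uv k0 lB lq Bmono qu H.
have [K K0 qK] := lq.
pose K1 := K * (v - u).
have K10 : 0 <= K1 by rewrite mulr_ge0// subr_ge0.
pose G n t := K1 * 2^-1 ^+ n * expR (2 * k * (B t - B u)).
have G0 n t : 0 <= G n t by rewrite /G mulr_ge0 ?expR_ge0// mulr_ge0// exprn_ge0// invr_ge0.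
have GS n t : G n t = 2 * G n.+1 t by rewrite /G exprS; field.
have lG n : lip u v (G n).
  apply: lipM => //; first exact: lip_cst.
  apply: lip_expR => //; apply: lipM => //; first exact: lip_cst.
  by apply: lipD => //; exact: lip_cst.
have step n s t : u <= s -> s <= t -> t <= v -> q t - q s <= G n t.
  elim: n s t => [|n IH] s t us st tv.
    apply: (le_trans (ler_norm _)); apply: (le_trans (qK _ _ us st tv)).
    apply: (@le_trans _ _ K1); first by rewrite ler_wpM2l//; lra.
    rewrite /G expr0 mulr1 ler_peMr// -[leLHS]expR0 ler_expR.
    by rewrite !mulr_ge0 ?(ltW k0)// subr_ge0 Bmono//; lra.
  suff : q t - G n.+1 t <= q s - G n.+1 s by have := G0 n.+1 s; lra.
  apply: (@lip_nonincreasing _ u v (fun t => q t - G n.+1 t)) => //.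
    by apply: lipD => //; exact: lipN.
  apply: ae_mono H => {s t us st tv} t H utv.
  have [b0 dB [d dq dle]] := H utv.
  have [ut tv] : u < t /\ t < v by apply/andP.
  exists (d - b t * k * G n t).
    apply: derD => //; apply: derN.
    have := derZ (K1 * 2^-1 ^+ n.+1)
      (der_expR (derZ (2 * k) (derD dB (der_cst t (- B u))))).
    by move=> dG; apply: (is_derive_eq (f := G n.+1) dG); rewrite GS /G; ring.
  have bkG : 0 <= b t * k * G n t by rewrite mulr_ge0// mulr_ge0// ltW.
  rewrite subr_le0; case: dle => [d0|[c [th [uc ct th1 thk dle]]]].
    exact: le_trans bkG.
  apply: (le_trans dle); rewrite -mulrA ler_wpM2l//.
  have h1 := IH c t uc ct (ltW tv).
  have h2 := IH u t (lexx u) (ltW ut) (ltW tv).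
  have qt : q t <= G n t by lra.
  have e1 : (k - th) * q t <= (k - th) * G n t by rewrite ler_wpM2l//; lra.
  have e2 : th * (q t - q c) <= th * G n t by rewrite ler_wpM2l//; lra.
  lra.
move=> s t us st tv.
apply: (@geometric_vanish _ _ _ (K1 * expR (2 * k * (B t - B u))) 2^-1); [lra|lra|].
by move=> n; have := step n s t us st tv; rewrite /G; lra.
Qed.

End delay.

Section overshoot.
Variable R : realType.
Implicit Types (B b z xi h : R -> R) (u v s t : R).

(** In the application [xi t] is [x (h t)], and [xi t - z (h t)] is the neutral
term [a (h t) * x (g (h t))].  The delayed argument is only required to stay
right of [T1] once more than [r] units of [B] have elapsed. *)
Definition driven B b h z xi T1 T2 r al M := ae (fun t => T1 < t < T2 ->
  [/\ 0 <= b t, is_derive t 1 B (b t), is_derive t 1 z (- (b t * xi t)),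
    `|xi t| <= M & r < B t - B T1 ->
      [/\ T1 <= h t, h t <= t, B t - B (h t) <= r &
        `|xi t - z (h t)| <= al * M]]).

Lemma drivenN B b h z xi T1 T2 r al M : driven B b h z xi T1 T2 r al M ->
  driven B b h (fun t => - z t) (fun t => - xi t) T1 T2 r al M.
Proof.
apply: ae_mono => t H /H[h1 h2 h3 h4 h5]; split => //.
- have := derN h3; rewrite mulrN; apply.
- by rewrite normrN.
- by move=> /h5[k1 k2 k3 k4]; split => //; rewrite -opprD normrN.
Qed.

Lemma driven_le B b h z xi T1 T2 r al M beta : clock B beta ->
  driven B b h z xi T1 T2 r al M -> lip T1 T2 z ->
  forall s t, T1 <= s -> s <= t -> t <= T2 -> z t - z s <= M * (B t - B s).
Proof.
move=> cB H lz s t us st tv.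
suff : z t - M * B t <= z s - M * B s by lra.
apply: (@lip_nonincreasing _ T1 T2 (fun t => z t - M * B t)) => //.
  apply: lipD => //; apply: lipN; apply: lipM; first by lra.
    exact: lip_cst.
  exact: clock_lip cB.
apply: ae_mono H => {us st tv s t} t H /H[b0 dB dz xiM _].
exists (- (b t * xi t) - M * b t).
  by apply: derD => //; apply: derN; exact: derZ.
have : b t * (- xi t) <= b t * M.
  by rewrite ler_wpM2l//; move: xiM; rewrite ler_norml; lra.
lra.
Qed.

(** Chosen so that the exponential [P] below dominates [z] and its derivative
during the first [r] units of [B], when [z (h t)] is not controlled. *)
Definition transient_cst (r : R) := expR r * (expR 1 * (2 + r) + 1).

Lemma expR1_ge2 : 2 <= expR 1 :> R.
Proof. by have := expR_ge1Dx (1 : R); lra. Qed.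

(** The weight [expR (expR 1 * B)] is the critical one: the retarded factor
[expR (expR 1 * (B t - B c))] stays below [expR 1] exactly when the delay in
[B] is at most [(expR 1)^-1]. *)
Lemma overshoot_nonincreasing B b h z xi T1 T2 r al M beta : clock B beta ->
  driven B b h z xi T1 T2 r al M -> lip T1 T2 z -> T1 <= T2 ->
  0 <= M -> 0 <= al -> 0 <= r -> 0 <= 1 - 2 * al ->
  r <= (expR 1)^-1 + (1 - 2 * al) -> `|z T1| <= 2 * M ->
  let q t := expR (expR 1 * (B t - B T1)) *
    (z t - (1 - al) * M - transient_cst r * M * expR (- (B t - B T1))) in
  (forall t, T1 <= t -> t <= T2 -> q t <= 0) /\
  forall s t, T1 <= s -> s <= t -> t <= T2 -> q t <= q s.
Proof.
move=> cB H lz T12 M0 al0 r0 g0 rle zT1 q.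
have e2 := expR1_ge2; set e := expR 1 in q e2 rle *.
set C := transient_cst r in q *.
have C2 : 2 <= C.
  rewrite /C /transient_cst -/e.
  have h1 : 1 <= expR r by rewrite -expR0 ler_expR.
  have h2 : 2 <= e * (2 + r) + 1.
    have : 2 * 2 <= e * (2 + r) by apply: ler_pM => //; lra.
    lra.
  by apply: (le_trans h2); rewrite ler_peMl//; lra.
have zle := driven_le cB H lz.
have Bm := clock_mono cB.
have qT1 : q T1 <= 0.
  rewrite /q !subrr mulr0 oppr0 expR0 mul1r mulr1.
  have : 2 * M <= C * M by rewrite ler_wpM2r.
  have : al * M <= 1 * M by rewrite ler_wpM2r//; lra.
  by move: zT1; rewrite ler_norml; lra.
have lB : lip T1 T2 B by exact: clock_lip cB.
have lq : lip T1 T2 q.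
  apply: lipM => //.
    apply: lip_expR => //; apply: lipM => //; first exact: lip_cst.
    by apply: lipD => //; exact: lip_cst.
  apply: lipD; first by apply: lipD => //; exact: lip_cst.
  apply: lipN; apply: lipM => //; first exact: lip_cst.
  apply: lip_expR => //; apply: lipN.
  by apply: lipD => //; exact: lip_cst.
suff qn : forall s t, T1 <= s -> s <= t -> t <= T2 -> q t <= q s.
  by split => // t T1t tT2; exact: le_trans (qn _ _ (lexx _) T1t tT2) qT1.
apply: (@delay_nonincreasing _ B b q T1 T2 e) => //; first by lra.
  by move=> s t _ st _; exact: Bm.
apply: ae_mono H => t H tT; have [b0 dB dz xiM hr] := H tT.
have [T1t tT2] : T1 < t /\ t < T2 by apply/andP.
split => //.
pose P t := C * M * expR (- (B t - B T1)).
pose E t := expR (e * (B t - B T1)).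
have E0 s : 0 < E s by exact: expR_gt0.
have dL := derD dB (der_cst t (- B T1)).
have dq : is_derive t 1 q
    (E t * (b t * (e * (z t - (1 - al) * M - P t) - xi t + P t))).
  have dE := der_expR (derZ e dL).
  have dP := derZ (C * M) (der_expR (derN dL)).
  have dQ := derD (derD dz (der_cst t (- ((1 - al) * M)))) (derN dP).
  apply: (is_derive_eq (derM dE dQ)).
  by rewrite /E /P; ring.
eexists; first exact: dq.
(* early times: the transient term alone makes the derivative nonpositive *)
have [Ltr|rLt] := leP (B t - B T1) r.
  left; rewrite mulr_ge0_le0 ?(ltW (E0 t))// mulr_ge0_le0//.
  have Pge : (e * (2 + r) + 1) * M <= P t.
    rewrite /P /C /transient_cst -/e.
    have -> : expR r * (e * (2 + r) + 1) * M * expR (- (B t - B T1)) =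
      ((e * (2 + r) + 1) * M) * (expR r * expR (- (B t - B T1))) by ring.
    rewrite ler_peMr//; last by rewrite -expRD -expR0 ler_expR; lra.
    rewrite mulr_ge0// addr_ge0// mulr_ge0//; lra.
  have P0 : 0 <= P t.
    by rewrite /P mulr_ge0 ?expR_ge0// mulr_ge0//; lra.
  have zt : z t <= (2 + r) * M.
    have h1 := zle T1 t (lexx _) (ltW T1t) (ltW tT2).
    have h2 : M * (B t - B T1) <= M * r by rewrite ler_wpM2l.
    by move: zT1; rewrite ler_norml; lra.
  have k1 : e * z t <= e * ((2 + r) * M) by rewrite ler_wpM2l//; lra.
  have k2 : 2 * P t <= e * P t by rewrite ler_wpM2r.
  have k3 : 0 <= e * ((1 - al) * M).
    by rewrite mulr_ge0 ?mulr_ge0//; lra.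
  by move: xiM; rewrite ler_norml; lra.
right; have [T1h ht Bh xih] := hr rLt.
have inve0 : 0 < e^-1 by rewrite invr_gt0; lra.
(* a delay longer than 1/e is cut down to 1/e; the excess costs at most
   [(1 - 2 * al) * M] *)
have [c [hc ct Bc zc]] : exists c, [/\ h t <= c, c <= t, B t - B c <= e^-1 &
    z c - z (h t) <= (1 - 2 * al) * M].
  have [small|big] := leP (B t - B (h t)) e^-1.
    by exists (h t); split => //; rewrite subrr mulr_ge0.
  have [c [hc ct Bc]] : exists c, [/\ h t <= c, c <= t & B c = B t - e^-1].
    apply: (clock_ivt cB) => //; lra.
  exists c; split => //; first by rewrite Bc; lra.
  apply: (le_trans (zle _ _ T1h hc _)); first by lra.
  by rewrite mulrC ler_wpM2r//; lra.
exists c, (expR (e * (B t - B c))).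
have Btc := Bm _ _ ct.
split => //.
- exact: le_trans hc.
- by rewrite -expR0 ler_expR mulr_ge0//; lra.
- rewrite /e ler_expR -/e -ler_pdivlMl ?mulr1//; lra.
have -> : expR (e * (B t - B c)) * q c = E t * (z c - (1 - al) * M - P c).
  by rewrite /q mulrA -expRD /E; congr (expR _ * _); ring.
rewrite mulrCA ler_wpM2l//.
have -> : e * q t = E t * (e * (z t - (1 - al) * M - P t)).
  by rewrite /q /E /P; ring.
rewrite -mulrBr ler_pM2l//.
have PP : P t <= P c.
  have CM0 : 0 <= C * M by rewrite mulr_ge0//; lra.
  by rewrite /P ler_wpM2l// ler_expR; lra.
by move: xih; rewrite ler_norml; lra.
Qed.

End overshoot.

(** * The contraction estimate *)

Section contraction.
Variable R : realType.
Implicit Types (B b z xi h : R -> R) (u v s t : R).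

(** If [z] falls short of [F + P] by less than [d] at some time, it did so by
less than [E * d], with [E = expR (expR 1 * (r + 1))], during the preceding
[r + 1] units of [B], because the weighted difference [q] is nonincreasing.
Then [eta] and [N] are such that [E] times the shortfall [eta * M] and [E]
times the transient stay small against the drop of order [(1 - 2 * al) * M]
that [z] undergoes during the last unit. *)
Lemma upper_contraction (r al : R) : 0 <= al -> 0 < 1 - 2 * al -> 0 <= r ->
  r <= (expR 1)^-1 + (1 - 2 * al) ->
  exists eta N : R, 0 < eta < 1 /\
  forall (B b h z xi : R -> R) (T1 T2 M beta : R), clock B beta ->
  driven B b h z xi T1 T2 r al M -> lip T1 T2 z -> 0 <= M -> `|z T1| <= 2 * M ->
  forall t, T1 <= t -> t <= T2 -> N <= B t - B T1 -> z t <= (1 - al - eta) * M.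
Proof.
move=> al0 g0 r0 rle.
have e2 := expR1_ge2 R; set e : R := expR 1 in e2 rle.
pose C := transient_cst r.
pose gam := 1 - 2 * al.
pose E := expR (e * (r + 1)).
have E0 : 0 < E by exact: expR_gt0.
have eE : e <= E.
  rewrite /E /e ler_expR -/e.
  have : 1 * 1 <= e * (r + 1) by apply: ler_pM; lra.
  by rewrite mulr1.
have C0 : 0 < C.
  rewrite /C /transient_cst mulr_gt0 ?expR_gt0// -/e.
  have : 0 <= e * (2 + r) by rewrite mulr_ge0//; lra.
  lra.
pose eta := gam / (4 * E).
have eta0 : 0 < eta by rewrite /eta divr_gt0// mulr_gt0.
have etaE : eta * E = gam / 4 by rewrite /eta; field; lra.
(* [expR N >= 1 + N >= C / eta] makes the transient at most [eta * M] *)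
pose N := r + 1 + C / eta.
have Ceta : 0 < C / eta by rewrite divr_gt0.
have CN : C * expR (- N) <= eta.
  rewrite expRN ler_pdivrMr ?expR_gt0//.
  have : 1 + N <= expR N by exact: expR_ge1Dx.
  move=> /(ler_wpM2l (ltW eta0)); apply: le_trans.
  have -> : eta * (1 + N) = eta * (r + 2) + C by rewrite /N; field; lra.
  by rewrite lerDr mulr_ge0//; lra.
exists eta, N; split => [|B b h z xi T1 T2 M beta cB H lz M0 zT1 t1 T1t1 t1T2 Nt1].
  rewrite eta0/=; have : eta * 2 <= eta * E by rewrite ler_wpM2l//; lra.
  by rewrite etaE /gam; lra.
have T12 : T1 <= T2 by exact: le_trans t1T2.
have [qneg qn] := overshoot_nonincreasing cB H lz T12 M0 al0 r0 (ltW g0) rle zT1.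
rewrite leNgt; apply/negP => zt1.
have Bm := clock_mono cB.
set F := (1 - al) * M in qneg qn.
have etaM : eta * M * E = gam * M / 4 by rewrite mulrAC etaE; field.
have etaM0 : 0 <= eta * M by rewrite mulr_ge0// ltW.
have etaMe : eta * M * e <= gam * M / 4 by rewrite -etaM ler_wpM2l.
have etaMg : eta * M <= gam * M / 4.
  by rewrite (le_trans _ etaMe)// ler_peMr//; lra.
have P1 : C * M * expR (- (B t1 - B T1)) <= eta * M.
  rewrite mulrAC ler_wpM2r//; apply: le_trans CN.
  by rewrite ler_pM2l// ler_expR lerN2.
(* since q decreases, z was already close to its bound well before t1 *)
have zlow t : T1 <= t -> t <= t1 -> B t1 - B t <= r + 1 -> F - gam * M / 2 <= z t.
  move=> T1t tt1 Bt; have := qn t t1 T1t tt1 t1T2.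
  have -> : B t1 - B T1 = (B t1 - B t) + (B t - B T1) by ring.
  rewrite [e * _ in X in X -> _]mulrDr expRD -mulrA [expR (e * (B t1 - B t)) * _]mulrCA.
  rewrite ler_pM2l ?expR_gt0//.
  have -> : B t1 - B t + (B t - B T1) = B t1 - B T1 by ring.
  set X := z t1 - F - _ => qt.
  have X0 : - (2 * (eta * M)) <= X by rewrite /X /F -/C; lra.
  have th1 : expR (e * (B t1 - B t)) <= E.
    by rewrite /E ler_expR ler_wpM2l//; lra.
  have th0 : 0 <= expR (e * (B t1 - B t)) by exact: expR_ge0.
  have : expR (e * (B t1 - B t)) * - (2 * (eta * M)) <= expR (e * (B t1 - B t)) * X.
    by rewrite ler_wpM2l.
  have : expR (e * (B t1 - B t)) * (2 * (eta * M)) <= E * (2 * (eta * M)).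
    by rewrite ler_wpM2r//; lra.
  have : 0 <= C * M * expR (- (B t - B T1)).
    by rewrite mulr_ge0 ?expR_ge0// mulr_ge0// ltW.
  rewrite -/C in qt; lra.
have [c [T1c ct1 Bc]] : exists c, [/\ T1 <= c, c <= t1 & B c = B t1 - 1].
  by apply: (clock_ivt cB) => //; rewrite /N in Nt1; lra.
have drop : z t1 + gam * M / 2 * B t1 <= z c + gam * M / 2 * B c.
  apply: (@lip_nonincreasing _ c t1 (fun t => z t + gam * M / 2 * B t)) => //.
    apply: lipD; first exact: lip_sub lz.
    by apply: lipM => //; [exact: lip_cst|exact: clock_lip cB].
  apply: ae_mono H => t H /andP[ct tt1].
  have [|b0 dB dz xiM hr] := H; first by apply/andP; split; lra.
  exists (- (b t * xi t) + gam * M / 2 * b t).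
    by apply: derD => //; exact: derZ.
  have Bct := Bm _ _ (ltW ct).
  have [|T1h ht Bh xih] := hr; first by rewrite /N in Nt1; lra.
  have zh : F - gam * M / 2 <= z (h t) by apply: zlow => //; lra.
  have xig : gam * M / 2 <= xi t.
    by move: xih zh; rewrite /F /gam ler_norml; lra.
  have : b t * (gam * M / 2) <= b t * xi t by rewrite ler_wpM2l.
  lra.
have qc : z c <= F + C * M * expR (- (B c - B T1)).
  have := qneg c T1c (le_trans ct1 t1T2).
  by rewrite pmulr_rle0 ?expR_gt0// -/C; lra.
have Pc : C * M * expR (- (B c - B T1)) <= eta * M * e.
  have -> : - (B c - B T1) = - (B t1 - B T1) + 1 by rewrite Bc; ring.
  by rewrite expRD mulrA ler_wpM2r//; lra.
have : gam * M / 2 * B t1 - gam * M / 2 * B c = gam * M / 2 by rewrite Bc; ring.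
rewrite /F in qc; lra.
Qed.

Lemma delay_contraction (r al : R) : 0 <= al -> 0 < 1 - 2 * al -> 0 <= r ->
  r <= (expR 1)^-1 + (1 - 2 * al) ->
  exists eta N : R, 0 < eta < 1 /\
  forall (B b h z xi : R -> R) (T1 T2 M beta : R), clock B beta ->
  driven B b h z xi T1 T2 r al M -> lip T1 T2 z -> 0 <= M -> `|z T1| <= 2 * M ->
  forall t, T1 <= t -> t <= T2 -> N <= B t - B T1 -> `|z t| <= (1 - al - eta) * M.
Proof.
move=> al0 g0 r0 rle; have [eta [N [eta0 H]]] := upper_contraction al0 g0 r0 rle.
exists eta, N; split => // B b h z xi T1 T2 M beta cB dr lz M0 zT1 t T1t tT2 Nt.
rewrite ler_norml lerNl; apply/andP; split.
  apply: (H _ _ _ _ _ _ _ _ _ cB (drivenN dr)) => //; first exact: lipN.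
  by rewrite normrN.
exact: (H _ _ _ _ _ _ _ _ _ cB dr).
Qed.

End contraction.

(** * Solutions of the neutral equation *)

Section neutral.
Variable R : realType.
Variables (a b g h B : R -> R) (t0 al r beta : R).
Hypothesis t00 : 0 <= t0.
Hypothesis al0 : 0 <= al.
Hypothesis al_half : 0 < 1 - 2 * al.
Hypothesis a_le : forall t, t0 <= t -> `|a t| <= al.
Hypothesis cB : clock B beta.
Hypothesis hb : ae (fun t => 0 <= t -> 0 <= b t /\ is_derive t 1 B (b t)).
Hypothesis g_le : forall t : R, 0 <= t -> g t <= t.
Hypothesis h_le : ae (fun t => t0 <= t -> h t <= t /\ B t - B (h t) <= r).
Hypothesis g_null : null_preimage `[0, +oo[ g.
Hypothesis h_null : null_preimage `[0, +oo[ h.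

Variables (eta N : R).
Hypothesis eta01 : 0 < eta < 1.
Hypothesis contract : forall (z xi : R -> R) (T1 T2 M : R),
  driven B b h z xi T1 T2 r al M -> lip T1 T2 z -> 0 <= M -> `|z T1| <= 2 * M ->
  forall t, T1 <= t -> t <= T2 -> N <= B t - B T1 -> `|z t| <= (1 - al - eta) * M.

Lemma ae_comp (k : R -> R) (P : R -> Prop) : null_preimage `[0, +oo[ k ->
  ae P -> ae (fun t => 0 <= t -> P (k t)).
Proof.
move=> nk /nk; apply: negligibleS => t /= /not_implyP[t_ge0 nP].
by split => //; rewrite in_itv/= t_ge0.
Qed.

Section solution.
Variables (x : R -> R) (s p : R).
Hypothesis t0s : t0 <= s.
Let y t := x t - a t * x (g t).
Hypothesis x_init : forall t, t <= s -> `|x t| <= p.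
Hypothesis x_loc : forall T, exists M : R, ae (fun t => s <= t -> t <= T -> `|x t| <= M).
Hypothesis y_ac : loc_abs_continuous s y.
Hypothesis y_der : ae (fun t => s <= t -> is_derive t 1 y (- (b t * x (h t)))).

Let p0 : 0 <= p. Proof. by apply: le_trans (x_init (lexx s)). Qed.
Let s0 : 0 <= s. Proof. exact: le_trans t0s. Qed.

Lemma delayed_bound (k W : R -> R) T : null_preimage `[0, +oo[ k ->
  ae (fun t => t0 <= t -> k t <= t) ->
  p <= W s -> (forall u t, s <= u -> u <= t -> W u <= W t) ->
  ae (fun t => s <= t -> t <= T -> `|x t| <= W t) ->
  ae (fun t => s <= t -> t <= T -> `|x (k t)| <= W t).
Proof.
move=> nk k_le pW Wm xW.
apply: ae_mono (ae_and k_le (ae_comp nk xW)) => t [kt xk] st tT.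
have {}kt : k t <= t by apply: kt; exact: le_trans st.
have [ks|/ltW sk] := leP (k t) s.
  apply: (le_trans (x_init ks)); apply: (le_trans pW); exact: Wm.
apply: (le_trans (xk _ sk (le_trans kt tT))); last exact: Wm.
exact: le_trans st.
Qed.

Lemma gbound (W : R -> R) T : p <= W s ->
  (forall u t, s <= u -> u <= t -> W u <= W t) ->
  ae (fun t => s <= t -> t <= T -> `|x t| <= W t) ->
  ae (fun t => s <= t -> t <= T -> `|x (g t)| <= W t).
Proof.
apply: delayed_bound => //; apply: ae_all => t t0t; apply: g_le.
exact: le_trans t0t.
Qed.

Lemma hbound (W : R -> R) T : p <= W s ->
  (forall u t, s <= u -> u <= t -> W u <= W t) ->
  ae (fun t => s <= t -> t <= T -> `|x t| <= W t) ->
  ae (fun t => s <= t -> t <= T -> `|x (h t)| <= W t).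
Proof. by apply: delayed_bound => //; apply: ae_mono h_le => t H /H[]. Qed.

Lemma y_lip T : lip s T y.
Proof.
have [M xM] := x_loc T; pose M1 := Num.max p M.
have pM1 : p <= M1 by rewrite le_max lexx.
have xM1 : ae (fun t => s <= t -> t <= T -> `|x t| <= M1).
  apply: ae_mono xM => t H st tT; apply: (le_trans (H st tT)).
  by rewrite le_max lexx orbT.
have [sT|Ts] := leP s T; last first.
  by exists 0 => // u t su ut tT; have := lt_le_trans Ts su; lra.
have := @hbound (fun=> M1) T pM1 (fun _ _ _ _ => lexx _) xM1 => xh.
apply: (@ac_lip _ B beta b (fun t => x (h t)) y s T M1) => //.
- exact: le_trans pM1.
- exact: y_ac.
- apply: ae_mono (ae_and hb (ae_and y_der xh)) => t [Hb [Hy Hx]] /andP[st tT].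
  have [|b0 dB] := Hb; first by apply: le_trans (ltW st).
  by split => //; [apply: Hy; exact: ltW|apply: Hx; exact: ltW].
Qed.

Lemma y_init : `|y s| <= 2 * p.
Proof.
have hal := al_half.
have ag : `|a s * x (g s)| <= al * p.
  by rewrite normrM ler_pM ?a_le ?x_init// g_le.
have alp : al * p <= p by rewrite -[leRHS]mul1r ler_wpM2r//; lra.
have := ler_normB (x s) (a s * x (g s)); have := x_init (lexx s).
by rewrite -/(y s); lra.
Qed.

Lemma x_le_y t : t0 <= t -> `|x t| <= `|y t| + al * `|x (g t)|.
Proof.
move=> t0t; have -> : x t = y t + a t * x (g t) by rewrite /y subrK.
by apply: (le_trans (ler_normD _ _)); rewrite lerD2l normrM ler_wpM2r// a_le.
Qed.

(** Iteration of the equation on bounds of the form [A * expR (4 * B)]: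
integrating one with respect to [B] divides it by 4, and
[1/4 + al <= 3/4] leaves a contraction for the excess of [A] over [8 * p]. *)
Lemma growth T :
  ae (fun t => s <= t -> t <= T -> `|x t| <= 8 * p * expR (4 * (B t - B s))).
Proof.
have hal := al_half; have hp := p0.
have [M0 xM0] := x_loc T; pose M := Num.max 0 M0.
pose W n t := (8 * p + M * (3 / 4) ^+ n) * expR (4 * (B t - B s)).
have MM n : 0 <= M * (3 / 4) ^+ n.
  by rewrite mulr_ge0 ?exprn_ge0// ?le_max ?lexx//; lra.
have c0 n : 0 <= 8 * p + M * (3 / 4) ^+ n by have := MM n; lra.
have Bm := clock_mono cB.
have Wm n u t : u <= t -> W n u <= W n t.
  move=> ut; rewrite /W ler_wpM2l// ler_expR.
  by have := Bm _ _ ut; lra.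
have pW n : p <= W n s.
  by rewrite /W subrr mulr0 expR0 mulr1; have := MM n; lra.
have step n : ae (fun t => s <= t -> t <= T -> `|x t| <= W n t).
  elim: n => [|n IH].
    apply: ae_mono xM0 => t H st tT; apply: (le_trans (H st tT)).
    rewrite /W expr0 mulr1.
    have : 1 <= expR (4 * (B t - B s)).
      by rewrite -[leLHS]expR0 ler_expR; have := Bm _ _ st; lra.
    have M0M : M0 <= M by rewrite le_max lexx orbT.
    have M_ge0 : 0 <= M by rewrite le_max lexx.
    move=> E1; apply: (le_trans M0M); apply: (@le_trans _ _ (8 * p + M)); first lra.
    by rewrite ler_peMr//; lra.
  have xh := hbound (pW n) (fun u t _ ut => Wm n u t ut) IH.
  have xg := gbound (pW n) (fun u t _ ut => Wm n u t ut) IH.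
  have dW (t db : R) : is_derive t 1 B db -> is_derive t 1 (fun t => 4^-1 * W n t) (db * W n t).
    move=> dB; have := derZ (4^-1 * (8 * p + M * (3 / 4) ^+ n))
      (der_expR (derZ 4 (derD dB (der_cst t (- B s))))).
    move=> dG; have -> : (fun t => 4^-1 * W n t) = (fun t => 4^-1 * (8 * p + M * (3 / 4) ^+ n) * expR (4 * (B t - B s))).
      by apply/funext => w; rewrite /W mulrA.
    by apply: (is_derive_eq dG); rewrite /W; field.
  have lW : s <= T -> lip s T (fun t => - (4^-1 * W n t)).
    move=> sT; apply: lipN; apply: lipM => //; first exact: lip_cst.
    apply: lipM => //; first exact: lip_cst.
    apply: lip_expR => //; apply: lipM => //; first exact: lip_cst.
    by apply: lipD; [exact: clock_lip cB|exact: lip_cst].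
  have Hae := ae_and hb (ae_and y_der xh).
  have yW t : s <= t -> t <= T -> `|y t| <= 4^-1 * W n t.
    move=> st tT; have sT := le_trans st tT.
    have up : y t - 4^-1 * W n t <= y s - 4^-1 * W n s.
      apply: (@lip_nonincreasing _ s T (fun t => y t - 4^-1 * W n t)) => //.
        by apply: lipD; [exact: y_lip|exact: lW].
      apply: ae_mono Hae => w [Hb [Hy Hx]] /andP[/ltW sw /ltW wT].
      have [|b0 dB] := Hb; first exact: le_trans sw.
      eexists; first exact: derD (Hy sw) (derN (dW w _ dB)).
      have := Hx sw wT; rewrite ler_norml => /andP[k1 _].
      have : b w * (- x (h w)) <= b w * W n w by rewrite ler_wpM2l//; lra.
      lra.
    have dn : - y t - 4^-1 * W n t <= - y s - 4^-1 * W n s.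
      apply: (@lip_nonincreasing _ s T (fun t => - y t - 4^-1 * W n t)) => //.
        by apply: lipD; [apply: lipN; exact: y_lip|exact: lW].
      apply: ae_mono Hae => w [Hb [Hy Hx]] /andP[/ltW sw /ltW wT].
      have [|b0 dB] := Hb; first exact: le_trans sw.
      eexists; first exact: derD (derN (Hy sw)) (derN (dW w _ dB)).
      have := Hx sw wT; rewrite ler_norml => /andP[_ k1].
      have : b w * x (h w) <= b w * W n w by rewrite ler_wpM2l.
      lra.
    have Ws : 2 * p <= 4^-1 * W n s.
      by rewrite /W subrr mulr0 expR0 mulr1; have := MM n; lra.
    by have := y_init; rewrite !ler_norml => /andP[k1 k2]; apply/andP; split; lra.
  apply: ae_mono xg => t xg st tT.
  apply: (le_trans (x_le_y (le_trans t0s st))).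
  have k1 := yW t st tT.
  have k2 : al * `|x (g t)| <= 2^-1 * W n t.
    by apply: ler_pM => //; [lra|exact: xg].
  apply: (@le_trans _ _ (3 / 4 * W n t)); first lra.
  rewrite /W exprS mulrA ler_wpM2r ?expR_ge0//; lra.
apply: ae_mono (ae_foralln step) => t H st tT.
apply: (@geometric_vanish _ _ _ (M * expR (4 * (B t - B s))) (3 / 4)); [lra|lra|].
by move=> n; apply: (le_trans (H n st tT)); rewrite /W; lra.
Qed.

Lemma solution_driven T1 T2 M : s <= T1 ->
  ae (fun t => T1 <= t -> t <= T2 -> `|x (h t)| <= M) ->
  ae (fun t => T1 <= t -> t <= T2 -> `|x (g t)| <= M) ->
  driven B b h y (fun t => x (h t)) T1 T2 r al M.
Proof.
move=> sT1 xh xg.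
have := ae_and (ae_and hb y_der) (ae_and (ae_and h_le xh) (ae_comp h_null xg)).
apply: ae_mono => t [[Hb Hy] [[Hh Hx] Hxg]] /andP[/ltW T1t /ltW tT2].
have st := le_trans sT1 T1t; have t0t := le_trans t0s st.
have t_ge0 := le_trans t00 t0t.
have [b0 dB] := Hb t_ge0; have [ht Br] := Hh t0t.
split => //; [exact: Hy|exact: Hx|] => rB.
have T1h : T1 <= h t.
  rewrite leNgt; apply/negP => /ltW hT1.
  by have := clock_mono cB hT1; lra.
split => //.
have -> : x (h t) - y (h t) = a (h t) * x (g (h t)) by rewrite /y; ring.
rewrite normrM ler_pM//.
  by apply: a_le; exact: le_trans (le_trans t0s sT1) T1h.
by apply: Hxg => //; exact: le_trans tT2.
Qed.

Definition bound_cst := 8 * expR (4 * Num.max 0 N).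

(** Up to [N] units of [B] after [s] the growth bound applies; later the
contraction sends a bound [W] to [(1 - eta) * W], so the part of [W] above the
growth bound tends to 0. *)
Lemma bounded_upto T :
  ae (fun t => s <= t -> t <= T -> `|x t| <= bound_cst * p).
Proof.
have hal := al_half; have hp := p0; have /andP[eta0 eta1] := eta01.
have K1 : 1 <= bound_cst.
  have : 1 <= expR (4 * Num.max 0 N).
    by rewrite -[leLHS]expR0 ler_expR mulr_ge0// le_max lexx.
  by rewrite /bound_cst; lra.
have Kp : p <= bound_cst * p by rewrite ler_peMl.
have [M0 xM0] := x_loc T; pose M := Num.max 0 M0.
have M_ge0 : 0 <= M by rewrite le_max lexx.
pose W n := bound_cst * p + M * (1 - eta) ^+ n.
have Mn n : 0 <= M * (1 - eta) ^+ n by rewrite mulr_ge0// exprn_ge0//; lra.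
have pW n : p <= W n by rewrite /W; have := Mn n; lra.
have step n : ae (fun t => s <= t -> t <= T -> `|x t| <= W n).
  elim: n => [|n IH].
    apply: ae_mono xM0 => t H st tT; apply: (le_trans (H st tT)).
    have : M0 <= M by rewrite le_max lexx orbT.
    by rewrite /W expr0 mulr1; lra.
  have xh := @hbound (fun=> W n) T (pW n) (fun _ _ _ _ => lexx _) IH.
  have xg := @gbound (fun=> W n) T (pW n) (fun _ _ _ _ => lexx _) IH.
  have D := solution_driven (lexx s) xh xg.
  have ys : `|y s| <= 2 * W n by have := y_init; have := pW n; lra.
  have W0 : 0 <= W n by exact: le_trans (pW n).
  have WS : (1 - eta) * W n <= W n.+1.
    have -> : (1 - eta) * W n = (1 - eta) * (bound_cst * p) + M * (1 - eta) ^+ n.+1.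
      by rewrite /W exprS; ring.
    rewrite /W lerD2r.
    have : 0 <= eta * (bound_cst * p) by apply: mulr_ge0; [exact: ltW|exact: le_trans Kp].
    lra.
  apply: ae_mono (ae_and xg (growth T)) => t [Hg Hgr] st tT.
  have [NB|/ltW BN] := leP N (B t - B s).
    have yt := contract D (@y_lip T) W0 ys st tT NB.
    have := x_le_y (le_trans t0s st).
    have : al * `|x (g t)| <= al * W n by rewrite ler_wpM2l// Hg.
    by lra.
  apply: (le_trans (Hgr st tT)).
  apply: (@le_trans _ _ (bound_cst * p)); last by have := Mn n.+1; rewrite /W; lra.
  rewrite /bound_cst mulrAC ler_wpM2r// ler_pM2l// ler_expR.
  by rewrite ler_pM2l// le_max BN orbT.
apply: ae_mono (ae_foralln step) => t H st tT.
apply: (@geometric_vanish _ _ _ M (1 - eta)); [lra|lra|].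
by move=> n; exact: H.
Qed.

Lemma solution_bounded : ae (fun t => s <= t -> `|x t| <= bound_cst * p).
Proof.
apply: ae_mono (ae_foralln (fun n => bounded_upto (s + n%:R))) => t H st.
apply: (H (Num.truncn (t - s)).+1 st).
have := truncnS_gt (t - s); lra.
Qed.

(** Restart the contraction at ever later times [T1], beyond which both delayed
arguments only see the region where the current bound holds. *)
Lemma solution_vanishes (lim_g : forall T, exists T', forall t, T' <= t -> T <= g t)
  (lim_h : forall T, exists T', forall t, T' <= t -> T <= h t)
  (lim_B : forall K, exists T, forall t, T <= t -> K <= B t) (e : R) : 0 < e ->
  exists T, ae (fun t => T <= t -> `|x t| < e).
Proof.
move=> e0; have hal := al_half; have /andP[eta0 eta1] := eta01.
have hal0 := al0.
pose M0 := Num.max 0 (bound_cst * p).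
have M00 : 0 <= M0 by rewrite le_max lexx.
have step n : exists2 T, s <= T & ae (fun t => T <= t -> `|x t| <= M0 * (1 - eta) ^+ n).
  elim: n => [|n [T sT IH]].
    exists s => //; apply: ae_mono solution_bounded => t H st.
    by rewrite expr0 mulr1 le_max (H st) orbT.
  set M := M0 * (1 - eta) ^+ n in IH.
  have M_ge0 : 0 <= M by rewrite mulr_ge0// exprn_ge0//; lra.
  have [Tg hTg] := lim_g T; have [Th hTh] := lim_h T.
  pose T' := Num.max T (Num.max Tg Th).
  have TT' : T <= T' by rewrite le_max lexx.
  have T'0 t : T' <= t -> 0 <= t.
    by move=> T't; apply: le_trans T't; apply: le_trans TT'; apply: le_trans sT.
  have xg : ae (fun t => T' <= t -> `|x (g t)| <= M).
    apply: ae_mono (ae_comp g_null IH) => t H T't; apply: H; first exact: T'0.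
    by apply: hTg; move: T't; rewrite !ge_max => /and3P[].
  have xh : ae (fun t => T' <= t -> `|x (h t)| <= M).
    apply: ae_mono (ae_comp h_null IH) => t H T't; apply: H; first exact: T'0.
    by apply: hTh; move: T't; rewrite !ge_max => /and3P[].
  (* [y T1] is bounded through [x T1] and [x (g T1)], hence [T1] has to avoid a
     null set *)
  have [T1 T'T1 [IH1 xg1]] := ae_exists T' (ae_and IH xg).
  have sT1 : s <= T1 by apply: le_trans T'T1; apply: le_trans TT'.
  have alM : al * M <= M by rewrite -[leRHS]mul1r ler_wpM2r//; lra.
  have yT1 : `|y T1| <= 2 * M.
    have h1 := IH1 (le_trans TT' T'T1).
    have h2 : `|a T1 * x (g T1)| <= al * M.
      by rewrite normrM ler_pM// ?xg1// a_le//; exact: le_trans sT1.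
    by have := ler_normB (x T1) (a T1 * x (g T1)); rewrite -/(y T1); lra.
  have [T2 hT2] := lim_B (N + B T1).
  exists (Num.max T1 T2); first by rewrite le_max sT1.
  apply: ae_mono (xg) => t Hg; rewrite ge_max => /andP[T1t T2t].
  have D : driven B b h y (fun t => x (h t)) T1 t r al M.
    apply: solution_driven => //.
      by apply: ae_mono xh => w H T1w _; apply: H; exact: le_trans T1w.
    by apply: ae_mono xg => w H T1w _; apply: H; exact: le_trans T1w.
  have Lt : lip T1 t y by apply: lip_sub (@y_lip t).
  have NB : N <= B t - B T1 by have := hT2 t T2t; lra.
  have yt := contract D Lt M_ge0 yT1 T1t (lexx t) NB.
  have := x_le_y (le_trans t0s (le_trans sT1 T1t)).
  have : al * `|x (g t)| <= al * M.
    by rewrite ler_wpM2l// Hg//; exact: le_trans T1t.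
  have -> : M0 * (1 - eta) ^+ n.+1 = (1 - eta) * M by rewrite /M exprS; ring.
  lra.
apply: contrapT => nT.
suff : e <= 0 by rewrite leNgt e0.
apply: (@geometric_vanish _ _ _ M0 (1 - eta)); [lra|lra|].
move=> n; rewrite add0r leNgt; apply/negP => lt_e; apply: nT.
have [T _ xT] := step n; exists T; apply: ae_mono xT => t H Tt.
exact: le_lt_trans (H Tt) lt_e.
Qed.

End solution.
End neutral.

(** * The theorem *)

Lemma ess_norm_ae (R : realType) (D : set R) (f : R -> R) :
  (ess_norm D f < +oo)%E -> exists M : R, ae (fun t => D t -> `|f t| <= M).
Proof.
move=> /ess_supr_bounded[M HM]; exists M.
by apply: ae_mono HM => t /= + Dt; rewrite patchE mem_set.
Qed.

(** Truncating [b] to values between 0 and an essential bound, and extending it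
by 0, changes it on a null set of nonnegative times only. *)
Lemma integral_clock (R : realType) (b : R -> R) :
  lebesgue_measurable_fun `[0, +oo[ b ->
  (ess_norm `[0%R, +oo[ b < +oo)%E ->
  ae (fun t => 0 <= t -> 0 <= b t) ->
  (\int[leb R]_(s in `[0%R, +oo[) (b s)%:E = +oo)%E ->
  exists (B : R -> R) (beta : R), [/\ clock B beta,
    ae (fun t => 0 <= t -> 0 <= b t /\ is_derive t 1 B (b t)),
    forall u t, u <= t -> (integral_from b u t = (B t - B u)%:E)%E &
    forall K, exists T, forall t, T <= t -> K <= B t].
Proof.
move=> mb /ess_norm_ae[M0 bM0] b0 intb.
pose M := Num.max 0 M0; have M_ge0 : 0 <= M by rewrite le_max lexx.
pose d t := Num.max 0 (Num.min (b t) M).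
pose c := patch (fun=> 0) `[0, +oo[ d.
have cE t : 0 <= t -> c t = d t by move=> t0; rewrite /c patchE mem_set//= in_itv/= t0.
have c_neg (t : R) : t < 0 -> c t = 0.
  by move=> t0; rewrite /c patchE memNset//= in_itv/= leNgt t0.
have mI : measurable (`[0, +oo[%classic : set (lebesgueT R)).
  by apply: borel_lebesgue; exact: measurable_itv.
have md : lebesgue_measurable_fun `[0, +oo[ d.
  apply: measurable_maxr; first exact: measurable_cst.
  by apply: measurable_minr => //; exact: measurable_cst.
have mc : lebesgue_measurable_fun setT c by apply/(measurable_restrictT _ _).1.
have c0M t : 0 <= c t <= M.
  have [t0|t0] := leP 0 t; last by rewrite c_neg// lexx.
  by rewrite cE// /d le_max lexx/= ge_max M_ge0/= ge_min lexx orbT.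
have cb : ae (fun t => 0 <= t -> c t = b t).
  apply: ae_mono (ae_and bM0 b0) => t [H1 H2] t0.
  have bM : b t <= M.
    apply: le_trans (ler_norm _) _; apply: (le_trans (H1 _)).
      by rewrite /= in_itv/= t0.
    by rewrite le_max lexx orbT.
  by rewrite cE// /d (min_idPl bM) (max_idPr (H2 t0)).
have [B [cB dB BE]] := primitive_exists mc c0M c_neg.
exists B, M; split => //.
- apply: ae_mono (ae_and dB (ae_and cb b0)) => t [H1 [H2 H3]] t0.
  by split; [exact: H3|rewrite -H2].
- move=> u t ut; rewrite -BE// /integral_from.
  have mU : measurable (`[u, t]%classic : set (lebesgueT R)).
    by apply: borel_lebesgue; exact: measurable_itv.
  apply: ae_eq_integral; first exact: mU.
  + apply/measurable_EFinP; have /(measurable_restrictT _ mI) := mb.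
    by apply: measurable_funS => //; exact: measurableT.
  + by apply/measurable_EFinP; apply: measurable_funS mc.
  + apply: ae_mono cb => w H _; congr (_%:E); rewrite patchE.
    case: ifPn => [|]; first by rewrite inE/= in_itv/= andbT => /H.
    rewrite notin_setE/= in_itv/= andbT => /negP; rewrite -ltNge => w0.
    by rewrite c_neg.
- move=> K; apply: contrapT => nK.
  have BK t : B t <= K.
    rewrite leNgt; apply/negP => KB; apply: nK; exists t => w tw.
    by apply: (le_trans (ltW KB)); exact: clock_mono cB _ _ tw.
  have intc : (\int[leb R]_(s in `[0%R, +oo[) (c s)%:E = +oo)%E.
    rewrite -intb; apply: ae_eq_integral; first exact: mI.
    + by apply/measurable_EFinP; apply: measurable_funS mc.
    + exact/measurable_EFinP.
    + by apply: ae_mono cb => w H; rewrite /= in_itv/= andbT => /H ->.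
  pose F (n : nat) : set (lebesgueT R) := `[0, n%:R]%classic.
  have CV : (\int[leb R]_(w in F n) (c w)%:E @[n --> \oo] -->
      \int[leb R]_(w in \bigcup_n F n) (c w)%:E)%E.
    apply: ge0_nondecreasing_set_cvg_integral.
    + move=> m n mn; apply/subsetPset => w; rewrite /F/= !in_itv/= => /andP[-> wm] /=.
      by apply: (le_trans wm); rewrite ler_nat.
    + by move=> n; apply: borel_lebesgue; exact: measurable_itv.
    + by move=> n; apply/measurable_EFinP; apply: measurable_funS mc.
    + by move=> n w _; rewrite lee_fin; have /andP[] := c0M w.
  have : (\int[leb R]_(w in `[0%R, +oo[) (c w)%:E <= (K - B 0)%:E)%E.
    have -> : `[0%R, +oo[%classic = \bigcup_n F n.
      apply/seteqP; split => w /=; rewrite in_itv/=.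
        rewrite andbT => w0; exists (Num.truncn w).+1 => //.
        by rewrite /F/= in_itv/= w0 ltW// truncnS_gt.
      by move=> [n _]; rewrite /F/= in_itv/= andbT => /andP[].
    rewrite -(cvg_lim _ CV)//; apply: lime_le; first exact: cvgP CV.
    by apply: nearW => n; rewrite /F BE// lee_fin lerD2r.
  by rewrite intc.
Qed.

Lemma cvg_pinfty_ge (R : realType) (k : R -> R) : k t @[t --> +oo] --> +oo ->
  forall T, exists T', forall t, T' <= t -> T <= k t.
Proof.
move=> /cvgryPge kl T; have [M [_ HM]] := kl T.
by exists (M + 1) => t Mt; apply: HM; lra.
Qed.

Lemma initial_bounded (R : realType) (s : R) (phi : R -> R) :
  initial_function s phi -> exists p, forall t, t <= s -> `|phi t| <= p.
Proof.
move=> [_ [M [_ HM]]]; exists (M + 1) => t ts.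
by apply: (HM (M + 1)); [lra|rewrite /= in_itv].
Qed.

Lemma solution_facts (R : realType) (a b g h : R -> R) (s : R) (phi x : R -> R) :
  is_solution a b g h s phi x ->
  [/\ forall T, exists M : R, ae (fun t => s <= t -> t <= T -> `|x t| <= M),
    loc_abs_continuous s (fun t => x t - a t * x (g t)),
    ae (fun t => s <= t ->
      is_derive t 1 (fun t => x t - a t * x (g t)) (- (b t * x (h t)))) &
    forall t, t <= s -> x t = phi t].
Proof.
move=> [_ xb yac yd xi]; split => //.
  move=> T; have [M HM] := ess_norm_ae (xb T); exists M.
  by apply: ae_mono HM => t H st tT; apply: H; rewrite /= in_itv/= st.
apply: ae_mono yd => t H /H[dy ye]; apply: DeriveDef => //.
by rewrite -derive1E; apply/eqP; rewrite -addr_eq0 ye.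
Qed.

Unset Implicit Arguments.
Theorem theorem3p6 (R : realType) (a b g h : R -> R) (t0 a0 : R)
  (a_meas : lebesgue_measurable_fun `[0, +oo[ a)
  (a_bnd : (ess_norm `[0%R, +oo[ a < +oo)%E)
  (b_meas : lebesgue_measurable_fun `[0, +oo[ b)
  (b_bnd : (ess_norm `[0%R, +oo[ b < +oo)%E)
  (g_meas : lebesgue_measurable_fun `[0, +oo[ g)
  (g_bnd : loc_ess_bounded 0 g)
  (h_meas : lebesgue_measurable_fun `[0, +oo[ h)
  (h_bnd : loc_ess_bounded 0 h)
  (g_le : forall t : R, 0 <= t -> g t <= t)
  (h_le : \forall t \ae leb R, 0 <= t -> h t <= t)
  (g_lim : g t @[t --> +oo] --> +oo)
  (h_lim : h t @[t --> +oo] --> +oo)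
  (g_null : null_preimage `[0, +oo[ g)
  (h_null : null_preimage `[0, +oo[ h)
  (t0_ge0 : 0 <= t0)
  (a_le_a0 : (ess_norm `[t0, +oo[ a <= a0%:E)%E)
  (a0_lt1 : a0 < 1)
  (a_repr : forall t : R, t0 <= t -> (`|a t|%:E <= ess_norm `[t0, +oo[ a)%E)
  (b_ge0 : \forall t \ae leb R, 0 <= t -> 0 <= b t)
  (b_int : (\int[leb R]_(s in `[0%R, +oo[) (b s)%:E = +oo)%E)
  (b_neq0 : \forall t \ae leb R, 0 <= t -> b t != 0)
  (g_limsup :
    (limf_esup (fun t : R => integral_from b (g t) t) (pinfty_nbhs R) < +oo)%E)
  (h_limsup :
    (limf_esup (fun t : R => integral_from b (h t) t) (pinfty_nbhs R) < +oo)%E)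
  (cond :
    ((\forall t \ae leb R, t0 <= t ->
        (integral_from b (h t) t <= ((expR 1)^-1)%:E)%E) /\
     (ess_norm `[t0, +oo[ a < (2^-1)%:E)%E)
    \/
    (\forall t \ae leb R, t0 <= t ->
       (((expR 1)^-1)%:E < integral_from b (h t) t)%E /\
       (integral_from b (h t) t
          < (1 + (expR 1)^-1)%:E - 2%:E * ess_norm `[t0, +oo[ a)%E)) :
  asymptotically_stable t0 a b g h.
Proof.
have [al alE] : exists al : R, ess_norm `[t0, +oo[ a = al%:E.
  exists (fine (ess_norm `[t0, +oo[ a)); rewrite fineK// ge0_fin_numE.
    exact: le_lt_trans a_le_a0 (ltry _).
  by apply: le_trans (a_repr t0 (lexx _)); rewrite lee_fin.
have a_le t : t0 <= t -> `|a t| <= al by move=> /a_repr; rewrite alE lee_fin.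
have al0 : 0 <= al by apply: le_trans (a_le t0 (lexx _)).
rewrite alE in cond.
(* this delay bound is common to both alternatives; in the second one
   [al < 1/2] because the two strict bounds on the integral are compatible at
   some [t] *)
pose r := (expR 1)^-1 + (1 - 2 * al).
have [al_half hr] : 0 < 1 - 2 * al /\
    ae (fun t => t0 <= t -> (integral_from b (h t) t <= r%:E)%E).
  have inve : 0 < (expR 1)^-1 :> R by rewrite invr_gt0 expR_gt0.
  case: cond => [[Hd]|Hd].
    rewrite lte_fin => al2; have al2' : 0 < 1 - 2 * al by lra.
    split => //; apply: ae_mono Hd => t H /H /le_trans; apply.
    by rewrite lee_fin /r lerDl ltW.
  have [t t0t /(_ t0t) [H1 H2]] := ae_exists t0 (Hd : ae _).
  split.
    by have := lt_trans H1 H2; rewrite -EFinM -EFinB lte_fin; lra.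
  apply: ae_mono Hd => w H /H[_ /ltW/le_trans]; apply.
  by rewrite -EFinM -EFinB lee_fin /r; lra.
have r0 : 0 <= r by rewrite /r addr_ge0 ?invr_ge0 ?expR_ge0// ltW.
have [B [beta [cB hb BE lim_B]]] := integral_clock b_meas b_bnd b_ge0 b_int.
have hh : ae (fun t => t0 <= t -> h t <= t /\ B t - B (h t) <= r).
  apply: ae_mono (ae_and hr (h_le : ae _)) => t [H1 H2] t0t.
  have ht : h t <= t by apply: H2; exact: le_trans t0t.
  by split => //; have := H1 t0t; rewrite BE// lee_fin.
have [eta [N [eta01 contr]]] := delay_contraction al0 al_half r0 (lexx r).
have contr' z xi T1 T2 M := @contr B b h z xi T1 T2 M beta cB.
have g0 := g_le.
split.
- move=> s t0s e e0.
  have K0 : 0 < bound_cst N by rewrite /bound_cst mulr_gt0// expR_gt0.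
  exists (e / 2 / bound_cst N); first by rewrite !divr_gt0.
  move=> phi x _ /solution_facts[x_loc yac yd xphi] sup_lt.
  have x_init t : t <= s -> `|x t| <= e / 2 / bound_cst N.
    move=> ts; rewrite xphi//; rewrite -lee_fin; apply: le_trans (ltW sup_lt).
    by apply: ereal_sup_ubound; exists t => //=; rewrite in_itv.
  have := solution_bounded t0_ge0 al0 al_half a_le cB hb g0 hh g_null h_null
    eta01 contr' t0s x_init x_loc yac yd.
  apply: ae_mono => t H /H /le_lt_trans; apply.
  by rewrite mulrC divfK ?gt_eqF//; lra.
- move=> s phi x t0s /initial_bounded[p phip] /solution_facts[x_loc yac yd xphi] e e0.
  have x_init t : t <= s -> `|x t| <= p by move=> ts; rewrite xphi// phip.
  have [T HT] := solution_vanishes t0_ge0 al0 al_half a_le cB hb g0 hh g_null h_null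
    eta01 contr' t0s x_init x_loc yac yd (cvg_pinfty_ge g_lim) (cvg_pinfty_ge h_lim)
    lim_B e0.
  exists T; apply: ae_mono HT => t H Tt.
  by have := H Tt; rewrite -{1}(subr0 (x t)).
Qed.
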